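(* There exist absolute constants $c, C, C' > 0$ such that for all integers $m \ge 2$ and $n \ge c\, m^3\log^2 m$, if $M$ is an $m \times n$ matrix whose columns are independent uniformly random unit vectors in $\mathbb{R}^m$, then $$\operatorname{disc}(M) \le C e^{-\sqrt{n/m^3}}$$ with probability at least $1 - C' L\sqrt{\frac{\log n}{n}}$, where $L = \sqrt{m}$.
   Context: A uniformly random unit vector is a uniformly random element of the Euclidean sphere $\mathbb{S}^{m-1}$. For a real $m\times n$ matrix $M$, $\operatorname{disc}(M) = \min_{v \in \{+1,-1\}^n}\|Mv\|_\infty$. *)

(* Defs.v *)
From mathcomp Require Export all_boot all_order all_algebra.
From mathcomp Require Export all_classical all_reals all_analysis.

Set Implicit Arguments.
Unset Strict Implicit.
Unset Printing Implicit Defensive.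

Export Order.TTheory GRing.Theory Num.Theory.
Export numFieldNormedType.Exports.

Local Open Scope classical_set_scope.
Local Open Scope ring_scope.

Section Discrepancy.
Context {R : realType} {m n : nat}.

Definition signing (s : {ffun 'I_n -> bool}) : 'cV[R]_n :=
  \col_j (-1) ^+ s j.

(** The library norm on matrices is the largest absolute value of an entry,
    hence the sup norm on column vectors.  The index family is never empty,
    and the default value of the iterated minimum is one of the values. *)
Definition disc (M : 'M[R]_(m, n)) : R :=
  \big[Num.min/ `|M *m signing [ffun=> false]|]_(s : {ffun 'I_n -> bool})
    `|M *m signing s|.

End Discrepancy.

(** R^m with its Borel sigma-algebra. *)
Notation borelV R m := (g_sigma_algebraType (@open 'cV[R]_m)).

Section Sphere.
Context {R : realType} {m : nat}.

Definition l2norm (u : 'cV[R]_m) : R := Num.sqrt (\sum_i u i ord0 ^+ 2).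

Definition unit_sphere : set (borelV R m) := [set u | l2norm u = 1].

Definition orthogonal_mx (Q : 'M[R]_m) : Prop := Q^T *m Q = 1%:M.

(** The uniform distribution on the sphere: the unique Borel probability
    measure carried by the sphere and invariant under the orthogonal group. *)
Definition uniform_on_sphere (mu : set (borelV R m) -> \bar R) : Prop :=
  mu unit_sphere = 1%E /\
  forall (Q : 'M[R]_m) (A : set (borelV R m)),
    orthogonal_mx Q -> measurable A ->
    mu [set u | A (Q *m (u : 'cV[R]_m))] = mu A.

End Sphere.

Definition mutually_independent {d d' : measure_display}
    {T : measurableType d} {E : measurableType d'} {R : realType}
    {I : finType} (P : probability T R) (X : I -> T -> E) : Prop :=
  forall (J : {set I}) (A : I -> set E),
    (forall j, j \in J -> measurable (A j)) ->
    P (\bigcap_(j in [set` J]) (X j @^-1` A j)) =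
    (\prod_(j in J) P (X j @^-1` A j))%E.

Section RandomColumns.
Context {d : measure_display} {T : measurableType d} {R : realType}.
Context {m n : nat}.

Definition column (M : T -> 'M[R]_(m, n)) (j : 'I_n) : T -> borelV R m :=
  fun w => col j (M w).

Definition indep_uniform_unit_columns (P : probability T R)
    (M : T -> 'M[R]_(m, n)) : Prop :=
  [/\ forall j, measurable_fun [set: T] (column M j),
      forall j, uniform_on_sphere (pushforward P (column M j)) &
      mutually_independent P (column M)].

End RandomColumns.

(* Main.v *)
Require Import Defs.
From mathcomp Require Import ring lra zify.
From mathcomp Require Import complex measurable_realfun.

Set Implicit Arguments.
Unset Strict Implicit.
Unset Printing Implicit Defensive.

Local Open Scope classical_set_scope.
Local Open Scope ring_scope.

(** The proof is a second moment argument carried out on a smoothed count of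
    the signings [v] for which [M v] is small.  The count [smoothed_count]
    averages over all signings the bump [prod_i cos (h (M v)_i) ^ (2 q)], with
    [h = 1 / n], so that no coordinate of [h M v] leaves [[-1, 1]].  If every
    signing has a coordinate above [exp (- S)], where [S = sqrt (n / m ^ 3)],
    all the bumps are tiny ([smoothed_count_small]); it therefore suffices to
    bound the count from below with high probability.

    The powers of the cosine have nonnegative Fourier coefficients, namely a
    binomial law on frequencies [theta], and the average over the signs turns
    each frequency into a product over columns ([smoothed_countE]):
      [count = sum_theta weight theta * prod_j cos <theta, x_j>].
    By independence the first and second moments are the sums of
    [prod_j E cos <theta, x_j>] and of
    [prod_j E (cos <theta, x_j> cos <theta', x_j>)].  Rotation invariance
    determines the second and fourth moments of a projection of a random unit
    vector, hence these expectations to second order in the squared lengths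
    [N] and [N'] of the frequencies ([Ex_cos_cos_ge], [Ex_cos_cos_le]), and
    keeps them away from one when [N + N' >= 1] ([Ex_cos_cos_far]).

    When [N] and [N'] are below a cutoff of order [m (m + ln n) / n], the
    second moment kernel is the product of two first moment kernels up to a
    factor [1 + O ((m + ln n) ^ 2 / n)] ([prod_t_near]).  Everything else is
    small compared with the main term.  Frequencies of squared length between
    the cutoff and one carry a Gaussian factor [exp (- (3 / 8) (n / m) (N + N'))];
    widening a Gaussian by a factor two multiplies its sum against the
    unimodal binomial weights by at most [4 ^ m] ([heat_doubling]), and the
    part of the exponent left over beats that factor.  Longer frequencies
    contribute [exp (- n / (8 m))] at most.  The main term is at least half the
    Gaussian sum at [n / m], and [exp (- n / (8 m))] is small even against the
    trivial lower bound [(2 q + 1) ^ (- m)] of that sum ([far_exponent],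
    [heat_ge]).

    Chebyshev's inequality around the main term then bounds the probability
    of failure by [O ((m + ln n) ^ 2 / n)] ([disc_small_probability]), and
    for [n] of order [m ^ 3] and larger this is
    [O (sqrt m * sqrt (ln n / n))] ([error_le]). *)

(** * Inequalities for cosine and exponential *)

Section RealInequalities.
Context {R : realType}.
Implicit Types (u x y : R) (f g : R -> R).

(** Comparison of two functions on the half-line through their derivatives;
    iterating it from [cos <= 1] gives the Taylor bounds below. *)
Lemma le_of_derivative f g (f' g' : R -> R) :
  (forall x, is_derive x 1 f (f' x)) -> (forall x, is_derive x 1 g (g' x)) ->
  f 0 <= g 0 -> (forall x, 0 <= x -> f' x <= g' x) ->
  forall x, 0 <= x -> f x <= g x.
Proof.
move=> df dg fg0 fg' x x0.
have dh y : is_derive y 1 (g - f) (g' y - f' y) by apply: is_deriveB.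
have der y : derivable (g - f) y 1 by apply: ex_derive; exact: dh.
suff: (g - f) 0 <= (g - f) x by rewrite !fctE; lra.
apply: (@ger0_derive1_le_cc R (g - f) 0 x) => //.
- move=> y; rewrite in_itv/= => /andP[y0 _].
  by rewrite derive1E derive_val subr_ge0; apply/fg'/ltW.
- apply: derivable_within_continuous => y _; exact: der.
- by rewrite in_itv/= lexx.
- by rewrite in_itv/= lexx x0.
Qed.

Lemma sin_le_id u : 0 <= u -> sin u <= u.
Proof.
apply: (@le_of_derivative sin id cos (fun=> 1)); by rewrite ?sin0.
Qed.

Lemma cos_ge u : 1 - u ^+ 2 / 2 <= cos u.
Proof.
wlog u0 : u / 0 <= u.
  move=> H; have [/H//|u0] := leP 0 u.
  by rewrite -cosN -sqrrN; apply: H; lra.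
move: u u0; apply: (@le_of_derivative _ _ (fun u => - u) (fun u => - sin u)).
- move=> x; apply: is_derive_eq; rewrite !scaler1 /GRing.scale/=; lra.
- by rewrite cos0; lra.
- by move=> x x0; rewrite lerN2 sin_le_id.
Qed.

Lemma sin_ge u : 0 <= u -> u - u ^+ 3 / 6 <= sin u.
Proof.
move: u; apply: (@le_of_derivative _ _ (fun u => 1 - u ^+ 2 / 2) cos).
- move=> x; apply: is_derive_eq; rewrite !scaler1 /GRing.scale/=; lra.
- by rewrite sin0; lra.
- by move=> x _; exact: cos_ge.
Qed.

Lemma cos_le u : cos u <= 1 - u ^+ 2 / 2 + u ^+ 4 / 24.
Proof.
wlog u0 : u / 0 <= u.
  move=> H; have [/H//|u0] := leP 0 u.
  rewrite -cosN -sqrrN -(_ : (- u) ^+ 4 = u ^+ 4); first by apply: H; lra.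
  by rewrite exprNn; lra.
move: u u0.
apply: (@le_of_derivative _ _ (fun u => - sin u) (fun u => - u + u ^+ 3 / 6)).
- move=> x; apply: is_derive_eq; rewrite !scaler1 /GRing.scale/=; lra.
- by rewrite cos0; lra.
- by move=> x /sin_ge; lra.
Qed.

Lemma cos_ge0_unit u : `|u| <= 1 -> 0 <= cos u.
Proof.
move=> u1; apply: le_trans (cos_ge u).
have : `|u| ^+ 2 <= 1 by rewrite expr_le1.
by rewrite real_normK ?num_real //; lra.
Qed.

Lemma expr_le_expR x y n : 0 <= x -> x <= 1 - y -> x ^+ n <= expR (- (n%:R * y)).
Proof.
move=> x0 xy; rewrite -mulrN expRM_natl lerXn2r ?nnegrE ?expR_ge0 //.
by apply: le_trans xy _; exact: expR_ge1Dx.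
Qed.

Lemma cosX_le_expR u n : `|u| <= 1 -> cos u ^+ n <= expR (- (n%:R * (u ^+ 2 / 4))).
Proof.
move=> u1; apply: expr_le_expR; first exact: cos_ge0_unit.
apply: le_trans (cos_le u) _.
have u2 : u ^+ 2 <= 1 by rewrite -(real_normK (num_real u)) expr_le1.
have : 0 <= u ^+ 2 by exact: sqr_ge0.
rewrite (_ : u ^+ 4 = u ^+ 2 * u ^+ 2); last by ring.
by nra.
Qed.

Lemma expR_le_1sub x : 0 <= x <= 1 / 2 -> expR (- (2 * x)) <= 1 - x.
Proof.
move=> /andP[x0 x1]; rewrite expRN.
have h : (1 + x) ^+ 2 <= expR (2 * x).
  rewrite expRM_natl lerXn2r ?nnegrE ?expR_ge0 ?expR_ge1Dx //; lra.
have p : 0 < expR (2 * x) by exact: expR_gt0.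
rewrite -div1r ler_pdivrMr //.
have : 0 <= (1 - x) * (expR (2 * x) - (1 + x) ^+ 2) by apply: mulr_ge0; lra.
have : 0 <= x * (1 / 2 - x) by apply: mulr_ge0; lra.
have : 0 <= x ^+ 2 * (1 / 2 - x) by apply: mulr_ge0; [exact: sqr_ge0|lra].
by lra.
Qed.

Lemma expR_sub1_le x : 0 <= x <= 1 / 2 -> expR x - 1 <= 2 * x.
Proof.
move=> /andP[x0 x1].
have F : 1 - x <= expR (- x) by exact: expR_ge1Dx.
have p := expR_gt0 x; have EF := expRxMexpNx_1 x.
have : 0 <= expR x * (expR (- x) - (1 - x)) by apply: mulr_ge0; lra.
rewrite mulrBr EF => H.
have : 0 <= x * (1 / 2 - x) by apply: mulr_ge0; lra.
move=> H2; rewrite lerBlDr -(ler_pM2r (_ : 0 < 1 - x)); lra.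
Qed.

End RealInequalities.
(** * Finite Fourier expansion of the smoothed count of good signings *)

Section Cis.
Context {R : realType}.
Implicit Types (u v : R).

Definition cis u : R[i] := (cos u +i* sin u)%C.

Lemma cisD u v : cis (u + v) = cis u * cis v.
Proof. by rewrite /cis cosD sinD; congr (_ +i* _)%C; rewrite addrC. Qed.

Lemma cis0 : cis 0 = 1.
Proof. by rewrite /cis cos0 sin0. Qed.

Lemma cis_sum (I : finType) (a : I -> R) :
  cis (\sum_i a i) = \prod_i cis (a i).
Proof. exact: (big_morph cis cisD cis0). Qed.

Lemma cisX u n : cis u ^+ n = cis (n%:R * u).
Proof.
elim: n => [|n IH]; first by rewrite mul0r cis0.
by rewrite exprS IH -cisD -natr1 mulrDl mul1r addrC.
Qed.

Lemma cis_add_conj u : cis u + cis (- u) = ((2 * cos u)%:C)%C.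
Proof.
rewrite /cis cosN sinN; apply/eqP; rewrite eq_complex /= subrr eqxx andbT.
by apply/eqP; ring.
Qed.

Lemma Re_sum (I : finType) (f : I -> R[i]) :
  Re (\sum_i f i) = \sum_i Re (f i).
Proof. exact: (big_morph (@Re R) (@raddfD _ _ (@Re R)) (raddf0 (@Re R))). Qed.

Lemma realC_prod (I : finType) (f : I -> R) :
  ((\prod_i f i)%:C)%C = \prod_i ((f i)%:C)%C :> R[i].
Proof. exact: rmorph_prod. Qed.

Lemma Re_realC_mul u (z : R[i]) : Re ((u%:C)%C * z) = u * Re z.
Proof. by case: z => a b /=; rewrite mul0r subr0. Qed.

(** Averaging over signs factorises: each factor is [cis a + cis (- a)]. *)
Lemma sum_signs_cos n (a : 'I_n -> R) :
  \sum_(s : {ffun 'I_n -> bool}) cos (\sum_j (-1) ^+ s j * a j)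
  = 2 ^+ n * \prod_j cos (a j).
Proof.
transitivity (Re (\prod_j \sum_(b : bool) cis ((-1) ^+ b * a j))).
  rewrite bigA_distr_bigA Re_sum; apply: eq_bigr => s _.
  by rewrite -cis_sum.
transitivity (Re (\prod_j ((2 * cos (a j))%:C)%C)).
  congr Re; apply: eq_bigr => j _.
  by rewrite big_bool /= expr1 expr0 mulN1r mul1r addrC cis_add_conj.
by rewrite -realC_prod /= big_split /= prodr_const card_ord.
Qed.

Variable q : nat.

(** The binomial law on the frequencies [-2q, -2q+2, ..., 2q]: the Fourier
    coefficients of [cos ^+ (2 q)]. *)
Definition coef (k : 'I_(2 * q).+1) : R := 'C(2 * q, k)%:R / 4 ^+ q.
Definition freq (k : 'I_(2 * q).+1) : R := 2 * (k%:R - q%:R).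

Lemma coef_ge0 k : 0 <= coef k.
Proof. by rewrite divr_ge0 ?exprn_ge0. Qed.

Lemma cosX_cis u :
  ((cos u ^+ (2 * q))%:C)%C = \sum_k ((coef k)%:C)%C * cis (freq k * u).
Proof.
have -> : cos u = (2 * cos u) / 2 by field.
rewrite expr_div_n [_ %:C%C]rmorphM /= [(_ ^+ (2 * q))%:C%C]rmorphXn /=.
rewrite -cis_add_conj addrC exprDn mulr_suml; apply: eq_bigr => k _.
rewrite !cisX -cisD /coef.
have -> : (2 * q - k)%:R * - u + k%:R * u = freq k * u.
  have kq : (k <= 2 * q)%N by rewrite -ltnS.
  by rewrite natrB // natrM /freq; ring.
rewrite [in RHS]rmorphM /= rmorph_nat [2 ^+ (2 * q)]exprM.
have -> : 2 ^+ 2 = 4 :> R by ring.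
by rewrite -mulr_natl; ring.
Qed.

Lemma sum_coef : \sum_k coef k = 1.
Proof.
have := cosX_cis 0; rewrite cos0 expr1n => /(congr1 (@Re R)) /= ->.
rewrite Re_sum; apply: eq_bigr => k _.
by rewrite Re_realC_mul mulr0 /= cos0 mulr1.
Qed.

Lemma prod_cosX m (a : 'I_m -> R) :
  \prod_i cos (a i) ^+ (2 * q)
  = \sum_(k : {ffun 'I_m -> 'I_(2 * q).+1})
      (\prod_i coef (k i)) * cos (\sum_i freq (k i) * a i).
Proof.
rewrite -[LHS]/(Re ((\prod_i cos (a i) ^+ (2 * q))%:C)%C) realC_prod.
under eq_bigr do rewrite cosX_cis.
rewrite bigA_distr_bigA Re_sum; apply: eq_bigr => k _.
by rewrite big_split /= -cis_sum -realC_prod Re_realC_mul.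
Qed.

End Cis.

Definition dot {R : realType} {m : nat} (u x : 'cV[R]_m) : R :=
  \sum_i u i ord0 * x i ord0.

Section SmoothedCount.
Context {R : realType} {m n : nat}.
Variables (q : nat) (h : R).
Implicit Types (M : 'M[R]_(m, n)) (k : {ffun 'I_m -> 'I_(2 * q).+1}).

(** A power of the cosine serves as the bump because its Fourier coefficients
    are nonnegative and unimodal; it is concentrated at the origin only within
    a period, so [h] has to keep [h * (M v)_i] in [[-1, 1]]. *)
Definition smoothed_count M : R :=
  (2 ^+ n)^-1 * \sum_(s : {ffun 'I_n -> bool})
    \prod_i cos (h * (M *m signing s) i ord0) ^+ (2 * q).

Definition weight k : R := \prod_i coef (k i).
Definition theta k : 'cV[R]_m := \col_i (h * freq (k i)).

Lemma weight_ge0 k : 0 <= weight k.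
Proof. by apply: prodr_ge0 => i _; exact: coef_ge0. Qed.

Lemma sum_weight : \sum_k weight k = 1.
Proof.
rewrite /weight -(bigA_distr_bigA (fun i => @coef R q)).
by rewrite sum_coef big1_eq.
Qed.

(** Expanding the bump in frequencies and then averaging over the signs turns
    the count into a sum of products with one factor per column. *)
Lemma smoothed_countE M :
  smoothed_count M
  = \sum_k weight k * \prod_j cos (dot (theta k) (col j M)).
Proof.
rewrite /smoothed_count.
under eq_bigr do rewrite prod_cosX.
rewrite exchange_big /= mulr_sumr; apply: eq_bigr => k _.
rewrite -mulr_sumr mulrCA; congr (_ * _).
transitivity ((2 ^+ n)^-1 * \sum_(s : {ffun 'I_n -> bool})
   cos (\sum_j (-1) ^+ s j * dot (theta k) (col j M))); last first.
  by rewrite sum_signs_cos mulKf // expf_neq0.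
congr (_ * _); apply: eq_bigr => s _; congr cos.
under [RHS]eq_bigr do rewrite mulr_sumr.
rewrite exchange_big /=; apply: eq_bigr => i _.
rewrite mxE !mulr_sumr; apply: eq_bigr => j _.
by rewrite !mxE; ring.
Qed.

(** Each signing has one coordinate whose bump is already this small, and the
    bumps of the other coordinates are at most one. *)
Lemma smoothed_count_small M (eps : R) : 0 <= eps -> 0 <= h ->
  (forall s i, `|h * (M *m signing s) i ord0| <= 1) ->
  (forall s, exists i, eps < `|(M *m signing s) i ord0|) ->
  smoothed_count M <= expR (- (q%:R * (h * eps) ^+ 2 / 2)).
Proof.
move=> e0 h0 small big.
rewrite ler_pdivrMl ?exprn_gt0 //.
have -> : (2 : R) ^+ n = #|{ffun 'I_n -> bool}|%:R.
  by rewrite card_ffun card_bool card_ord natrX.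
set b := expR _.
rewrite mulr_natl (_ : _ *+ _ = \sum_(s : {ffun 'I_n -> bool}) b); last first.
  by rewrite sumr_const.
apply: ler_sum => s _; rewrite /b.
have [i ei] := big s.
have c01 l : 0 <= cos (h * (M *m signing s) l ord0) ^+ (2 * q) <= 1.
  by rewrite exprn_ge0 ?exprn_ile1 ?cos_ge0_unit ?cos_le1.
rewrite (bigD1 i) //=.
apply: le_trans (_ : cos (h * (M *m signing s) i ord0) ^+ (2 * q) <= _).
  rewrite ler_piMr //; first by case/andP: (c01 i).
  by apply: prodr_ile1 => l _; exact: c01.
apply: le_trans (cosX_le_expR _ (small s i)) _.
rewrite ler_expR lerN2 natrM.
have -> : (h * (M *m signing s) i ord0) ^+ 2 = (h * `|(M *m signing s) i ord0|) ^+ 2.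
  by rewrite !exprMn real_normK ?num_real.
have H : (h * eps) ^+ 2 <= (h * `|(M *m signing s) i ord0|) ^+ 2.
  by rewrite lerXn2r ?nnegrE ?mulr_ge0 // ler_wpM2l // ltW.
by have := ler_wpM2l (ler0n R q) H; lra.
Qed.

End SmoothedCount.
(** * Expectations of bounded functions, independence and equality in law *)

Section Expectation.
Context {d : measure_display} {T : measurableType d} {R : realType}.
Variable P : probability T R.
Implicit Types (f g : T -> R).

Definition bounded_measurable f :=
  measurable_fun [set: T] f /\ exists B, forall w, `|f w| <= B.

Definition Ex f : R := \int[P]_w f w.

Lemma bm_integrable f : bounded_measurable f ->
  P.-integrable [set: T] (EFin \o f).
Proof.
move=> [mf [B fB]]; apply: measurable_bounded_integrable => //.
  by apply: le_lt_trans (probability_le1 _ _) _ => //; exact: ltry.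
exists B; split; first exact: num_real.
by move=> M BM w _ /=; apply: le_trans (fB w) _; exact: ltW.
Qed.

Lemma bm_cst (c : R) : bounded_measurable (fun=> c).
Proof. by split; [exact: measurable_cst|exists `|c|]. Qed.

Lemma bmD f g : bounded_measurable f -> bounded_measurable g ->
  bounded_measurable (fun w => f w + g w).
Proof.
move=> [mf [B fB]] [mg [C gC]]; split; first exact: measurable_funD.
by exists (B + C) => w; apply: le_trans (ler_normD _ _) _; exact: lerD.
Qed.

Lemma bmM f g : bounded_measurable f -> bounded_measurable g ->
  bounded_measurable (fun w => f w * g w).
Proof.
move=> [mf [B fB]] [mg [C gC]]; split; first exact: measurable_funM.
by exists (B * C) => w; rewrite normrM; apply: ler_pM.
Qed.

Lemma bm_sum (I : Type) (s : seq I) (Q : pred I) (F : I -> T -> R) :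
  (forall i, bounded_measurable (F i)) ->
  bounded_measurable (fun w => \sum_(i <- s | Q i) F i w).
Proof.
move=> bF; elim: s => [|i s IH].
  by under eq_fun do rewrite big_nil; exact: bm_cst.
under eq_fun do rewrite big_cons.
by case: (Q i) => //; exact: bmD.
Qed.

Lemma bm_prod (I : Type) (s : seq I) (Q : pred I) (F : I -> T -> R) :
  (forall i, bounded_measurable (F i)) ->
  bounded_measurable (fun w => \prod_(i <- s | Q i) F i w).
Proof.
move=> bF; elim: s => [|i s IH].
  by under eq_fun do rewrite big_nil; exact: bm_cst.
under eq_fun do rewrite big_cons.
by case: (Q i) => //; exact: bmM.
Qed.

Lemma bm_cos f : measurable_fun [set: T] f ->
  bounded_measurable (fun w => cos (f w)).
Proof.
move=> mf; split; last by exists 1 => w; exact: cos_max.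
apply: measurableT_comp mf; apply: continuous_measurable_fun.
exact: continuous_cos.
Qed.

Lemma bm_indicator (A : set T) : measurable A -> bounded_measurable (\1_A).
Proof.
move=> mA; split; first exact: measurable_indic.
by exists 1 => w; rewrite indicE; case: (_ \in _); rewrite ?normr1 ?normr0.
Qed.

Lemma Ex_cst (c : R) : Ex (fun=> c) = c.
Proof.
rewrite /Ex Rintegral_cst // -[RHS]mulr1 -[X in _ = _ * X]/(fine 1%E).
by congr (_ * fine _); exact: probability_setT.
Qed.

Lemma ExD f g : bounded_measurable f -> bounded_measurable g ->
  Ex (fun w => f w + g w) = Ex f + Ex g.
Proof. by move=> bf bg; apply: RintegralD => //; exact: bm_integrable. Qed.

Lemma ExZ (c : R) f : bounded_measurable f -> Ex (fun w => c * f w) = c * Ex f.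
Proof. by move=> bf; apply: RintegralZl => //; exact: bm_integrable. Qed.

Lemma Ex_le f g : bounded_measurable f -> bounded_measurable g ->
  (forall w, f w <= g w) -> Ex f <= Ex g.
Proof. by move=> bf bg fg; apply: le_Rintegral => //; exact: bm_integrable. Qed.

Lemma Ex_sum (I : Type) (s : seq I) (F : I -> T -> R) :
  (forall i, bounded_measurable (F i)) ->
  Ex (fun w => \sum_(i <- s) F i w) = \sum_(i <- s) Ex (F i).
Proof.
move=> bF; elim: s => [|i s IH].
  by under eq_fun do rewrite big_nil; rewrite Ex_cst big_nil.
under eq_fun do rewrite big_cons.
by rewrite ExD ?big_cons ?IH //; exact: bm_sum.
Qed.

Lemma Ex_norm_le f (B : R) : bounded_measurable f -> (forall w, `|f w| <= B) ->
  `|Ex f| <= B.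
Proof.
move=> bf fB; rewrite ler_norml; apply/andP; split.
  rewrite -(Ex_cst (- B)); apply: Ex_le => // [|w]; first exact: bm_cst.
  by have := fB w; rewrite ler_norml => /andP[].
rewrite -[leRHS](Ex_cst B); apply: Ex_le => // [|w]; first exact: bm_cst.
by have := fB w; rewrite ler_norml => /andP[].
Qed.

Lemma Ex_dist_le f g (B : R) :
  bounded_measurable f -> bounded_measurable g ->
  (forall w, `|f w - g w| <= B) -> `|Ex f - Ex g| <= B.
Proof.
move=> bf bg fg.
have bNg : bounded_measurable (fun w => - 1 * g w) by apply: bmM => //; exact: bm_cst.
have -> : Ex f - Ex g = Ex (fun w => f w + - 1 * g w).
  by rewrite ExD // ExZ // mulN1r.
by apply: Ex_norm_le => [|w]; [exact: bmD|rewrite mulN1r].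
Qed.

Lemma Ex_indicator (A : set T) : measurable A -> Ex (\1_A) = fine (P A).
Proof. by move=> mA; rewrite /Ex /Rintegral integral_indic ?setIT. Qed.

End Expectation.

Section Discretisation.
Context {R : realType}.
Implicit Types x : R.

Definition grid K (v : 'I_(2 * K).+1) : R := v%:R / K%:R - 1.
Definition bin K (v : 'I_(2 * K).+1) : set R :=
  [set x | grid v <= x < grid v + K%:R^-1].
(** A value in [[-1, 1]] rounded down to a multiple of [1 / K], written as a
    finite combination of indicators so that expectations reduce to
    probabilities. *)
Definition round_down K x : R := \sum_(v < (2 * K).+1) grid v * \1_(bin v) x.

Lemma measurable_bin K v : measurable (@bin K v).
Proof.
by rewrite (_ : bin v = `[grid v, grid v + K%:R^-1[%classic).
Qed.

Lemma round_downE K x : (0 < K)%N -> `|x| <= 1 ->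
  exists v : 'I_(2 * K).+1, round_down K x = grid v /\ grid v <= x < grid v + K%:R^-1.
Proof.
move=> K0; rewrite ler_norml => /andP[x1 x2].
have K0R : 0 < K%:R :> R by rewrite ltr0n.
have pos : 0 <= K%:R * (x + 1) by apply: mulr_ge0; lra.
have le2K : K%:R * (x + 1) <= (2 * K)%:R.
  by rewrite natrM [2 * _]mulrC ler_pM2l //; lra.
have [l u] := andP (truncn_itv pos).
have v2K : (Num.truncn (K%:R * (x + 1)) < (2 * K).+1)%N.
  by rewrite ltnS -(ler_nat R); exact: le_trans l le2K.
have inbin (v : 'I_(2 * K).+1) :
    (grid v <= x < grid v + K%:R^-1) = (Num.truncn (K%:R * (x + 1)) == v :> nat).
  rewrite /grid truncn_eq //; congr (_ && _).
    by rewrite lerBlDr ler_pdivrMr // mulrC.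
  rewrite (_ : _ - 1 + _ = (v.+1)%:R / K%:R - 1); last by rewrite -natr1; ring.
  by rewrite ltrBrDr ltr_pdivlMr // mulrC.
exists (Ordinal v2K); rewrite inbin eqxx; split=> //.
rewrite /round_down (bigD1 (Ordinal v2K)) //= big1 ?addr0.
  by rewrite indicE mem_set ?mulr1 // /bin /= inbin.
move=> v /eqP vN; rewrite indicE memNset ?mulr0 // /bin /= inbin => /eqP e.
by apply: vN; apply: val_inj.
Qed.

Lemma round_down_dist K x : (0 < K)%N -> `|x| <= 1 ->
  `|x - round_down K x| <= K%:R^-1.
Proof.
move=> K0 x1; have [v [-> /andP[h1 h2]]] := round_downE K0 x1.
by rewrite ler_norml; apply/andP; split; lra.
Qed.

Lemma round_down_le1 K x : (0 < K)%N -> `|x| <= 1 -> `|round_down K x| <= 1.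
Proof.
move=> K0 x1; have [v [-> /andP[h1 _]]] := round_downE K0 x1.
move: x1; rewrite !ler_norml => /andP[_ x1]; apply/andP; split; last by lra.
by rewrite /grid lerBrDr addNr divr_ge0.
Qed.

Lemma prod_dist_le (I : Type) (s : seq I) (a b : I -> R) (e : R) :
  (forall i, `|a i| <= 1) -> (forall i, `|b i| <= 1) ->
  (forall i, `|a i - b i| <= e) ->
  `|\prod_(i <- s) a i - \prod_(i <- s) b i| <= (size s)%:R * e.
Proof.
move=> a1 b1 ab; elim: s => [|i s IH]; first by rewrite !big_nil subrr normr0 mul0r.
rewrite !big_cons /=.
have -> : a i * \prod_(j <- s) a j - b i * \prod_(j <- s) b j =
  a i * (\prod_(j <- s) a j - \prod_(j <- s) b j) +
  (a i - b i) * \prod_(j <- s) b j by ring.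
apply: le_trans (ler_normD _ _) _; rewrite !normrM -natr1 mulrDl mul1r.
apply: lerD.
  by apply: le_trans IH; rewrite ler_piMl.
apply: le_trans (ab i); rewrite ler_piMr // normr_prod.
by apply: prodr_ile1 => j _; rewrite normr_ge0 b1.
Qed.

Lemma small_eq0 x (C : R) : (forall K, (0 < K)%N -> `|x| <= C / K%:R) -> x = 0.
Proof.
move=> H; apply/eqP; rewrite -normr_le0 leNgt; apply/negP => x0.
have C0 : 0 <= C by have := H 1%N isT; rewrite divr1; apply: le_trans.
pose K := (Num.truncn (C / `|x|)).+1.
have K1 : C / `|x| < K%:R by apply: truncnS_gt.
have := H K isT; rewrite leNgt => /negP; apply.
by rewrite ltr_pdivrMr ?ltr0n // mulrC -ltr_pdivrMr.
Qed.

End Discretisation.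

Section IndependenceLaw.
Context {d : measure_display} {T : measurableType d} {R : realType}.
Variable P : probability T R.

Lemma indicator_comp (E : Type) (X : T -> E) (A : set E) w :
  \1_(X @^-1` A) w = \1_A (X w) :> R.
Proof. by rewrite !indicE; congr (_%:R); apply: congr1; apply/idP/idP; rewrite !inE. Qed.

Lemma bm_round_down K (f : T -> R) : measurable_fun [set: T] f ->
  bounded_measurable (fun w => round_down K (f w)).
Proof.
move=> mf; apply: bm_sum => v; apply: bmM; first exact: bm_cst.
under eq_fun do rewrite -indicator_comp.
apply: bm_indicator; rewrite -[X in measurable X]setTI.
by apply: mf => //; exact: measurable_bin.
Qed.

Lemma Ex_round_down K (f : T -> R) : measurable_fun [set: T] f ->
  Ex P (fun w => round_down K (f w)) =
  \sum_(v < (2 * K).+1) grid v * fine (P (f @^-1` bin v)).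
Proof.
move=> mf.
have mA (v : 'I_(2 * K).+1) : measurable (f @^-1` (@bin R K v)).
  by rewrite -[X in measurable X]setTI; apply: mf => //; exact: measurable_bin.
rewrite Ex_sum => [|v].
  apply: eq_bigr => v _.
  under eq_fun do rewrite -indicator_comp.
  by rewrite ExZ ?Ex_indicator //; exact: bm_indicator.
under eq_fun do rewrite -indicator_comp.
by apply: bmM; [exact: bm_cst|exact: bm_indicator].
Qed.

(** Both expectations are limits of the same sums over bins. *)
Lemma Ex_law (f g : T -> R) :
  bounded_measurable f -> bounded_measurable g ->
  (forall B : set R, measurable B -> P (f @^-1` B) = P (g @^-1` B)) ->
  Ex P f = Ex P g.
Proof.
wlog [f1 g1] : f g / (forall w, `|f w| <= 1) /\ (forall w, `|g w| <= 1).
  move=> H bf bg fg; have [mf [B fB]] := bf; have [mg [C gC]] := bg.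
  pose D := `|B| + `|C| + 1.
  have D0 : 0 < D by rewrite ltr_wpDl // addr_ge0.
  have sc (a : R) : a = D * (D^-1 * a) by rewrite mulVKf // gt_eqF.
  have bz k : bounded_measurable k -> bounded_measurable (fun w => D^-1 * k w).
    by move=> bk; apply: bmM => //; exact: bm_cst.
  have le1 (k : T -> R) (a : R) : `|a| <= D -> (forall w, `|k w| <= a) ->
      forall w, `|D^-1 * k w| <= 1.
    move=> aD ka w; rewrite normrM gtr0_norm ?invr_gt0 // ler_pdivrMl // mulr1.
    by apply: le_trans (ka w) _; apply: le_trans (ler_norm _) aD.
  have -> : f = (fun w => D * (D^-1 * f w)) by apply/funext => w; exact: sc.
  have -> : g = (fun w => D * (D^-1 * g w)) by apply/funext => w; exact: sc.
  rewrite !(ExZ _ D); [congr (_ * _); apply: H|exact: bz|exact: bz].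
  - split; [apply: (le1 f B)|apply: (le1 g C)] => //;
    rewrite /D; have := normr_ge0 B; have := normr_ge0 C; lra.
  - exact: bz.
  - exact: bz.
  - move=> A mA; pose A' := [set x : R | A (D^-1 * x)].
    have mA' : measurable A'.
      rewrite /A' -[X in measurable X]setTI.
      by apply: (@mulrl_measurable R [set: R] D^-1).
    exact: (fg A' mA').
move=> bf bg fg; apply/eqP; rewrite -subr_eq0; apply/eqP.
apply: (@small_eq0 _ _ 2) => K K0.
have [mf _] := bf; have [mg _] := bg.
have e : Ex P (fun w => round_down K (f w)) = Ex P (fun w => round_down K (g w)).
  rewrite !Ex_round_down //; apply: eq_bigr => v _.
  by rewrite fg //; exact: measurable_bin.
have -> : Ex P f - Ex P g = (Ex P f - Ex P (fun w => round_down K (f w)))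
   - (Ex P g - Ex P (fun w => round_down K (g w))) by rewrite e; ring.
apply: le_trans (ler_normB _ _) _.
rewrite (_ : 2 / _ = K%:R^-1 + K%:R^-1); last by ring.
by apply: lerD; apply: Ex_dist_le => // [|w]; rewrite ?round_down_dist //;
  exact: bm_round_down.
Qed.

(** For indicator functions this is the definition of independence; rounding
    the factors down to a grid reduces to that case by multilinearity. *)
Lemma Ex_prod_indep {d' : measure_display} {E : measurableType d'}
    {I : finType} (X : I -> T -> E) (F : I -> E -> R) :
  mutually_independent P X ->
  (forall j, measurable_fun [set: T] (X j)) ->
  (forall j, measurable_fun [set: E] (F j)) ->
  (forall j w, `|F j (X j w)| <= 1) ->
  Ex P (fun w => \prod_j F j (X j w)) = \prod_j Ex P (fun w => F j (X j w)).
Proof.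
move=> ind mX mF F1.
have mFX j : measurable_fun [set: T] (fun w => F j (X j w)).
  by apply: measurableT_comp.
have bF j : bounded_measurable (fun w => F j (X j w)).
  by split => //; exists 1.
apply/eqP; rewrite -subr_eq0; apply/eqP.
apply: (@small_eq0 _ _ (2 * (size (index_enum I))%:R)) => K K0.
pose G j w := round_down K (F j (X j w)).
have bG j : bounded_measurable (G j) by exact: bm_round_down.
have mB j (v : 'I_(2 * K).+1) : measurable (F j @^-1` (@bin R K v)).
  by rewrite -[X in measurable X]setTI; apply: mF => //; exact: measurable_bin.
have mXB j (v : 'I_(2 * K).+1) : measurable (X j @^-1` (F j @^-1` (@bin R K v))).
  by rewrite -[X in measurable X]setTI; apply: mX.
have EG : Ex P (fun w => \prod_j G j w) = \prod_j Ex P (G j).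
  under [RHS]eq_bigr do rewrite Ex_round_down //.
  rewrite bigA_distr_bigA /=.
  have -> : (fun w => \prod_j G j w) = (fun w =>
     \sum_(s : {ffun I -> 'I_(2 * K).+1}) (\prod_j grid (s j)) *
       \1_(\bigcap_(j in [set` [set: I]%SET]) X j @^-1` (F j @^-1` bin (s j))) w).
    apply/funext => w; rewrite /G /round_down bigA_distr_bigA /=.
    apply: eq_bigr => s _; rewrite big_split /=; congr (_ * _).
    have [/[dup] inb /set_mem inb'|] := boolP (w \in \bigcap_(j in [set` [set: I]%SET])
         X j @^-1` (F j @^-1` bin (s j))).
      rewrite indicE inb big1 // => j _; rewrite indicE mem_set //.
      by apply: (inb' j); rewrite /= inE.
    move=> nin; rewrite indicE (negbTE nin).
    have [j nj] : exists j, F j (X j w) \notin bin (s j).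
      apply: contrapT => /forallNP all; move/negP: nin; apply.
      apply/mem_set => j _; apply/set_mem.
      by have /negP := all j; rewrite negbK.
    by rewrite (bigD1 j) //= indicE (negbTE nj) mul0r.
  have mcap (s : {ffun I -> 'I_(2 * K).+1}) :
    measurable (\bigcap_(j in [set` [set: I]%SET]) X j @^-1` (F j @^-1` (@bin R K (s j)))).
    by apply: fin_bigcap_measurable => // j _.
  rewrite Ex_sum => [|s]; last by apply: bmM; [exact: bm_cst|exact: bm_indicator].
  apply: eq_bigr => s _.
  rewrite ExZ ?Ex_indicator //; last exact: bm_indicator.
  rewrite big_split /=; congr (_ * _).
  rewrite (ind [set: I]%SET (fun j => F j @^-1` bin (s j))) //.
  rewrite [X in fine X](eq_bigl xpredT) => [|j]; last by rewrite finset.in_setT.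
  rewrite -(_ : \prod_j ((fine (P (X j @^-1` (F j @^-1` bin (s j)))))%:E) =
     \prod_j P (X j @^-1` (F j @^-1` bin (s j))))%E; last first.
    by apply: eq_bigr => j _; rewrite fineK // fin_num_measure.
  by rewrite prodEFin.
have -> : Ex P (fun w => \prod_j F j (X j w)) - \prod_j Ex P (fun w => F j (X j w)) =
   (Ex P (fun w => \prod_j F j (X j w)) - Ex P (fun w => \prod_j G j w)) +
   (\prod_j Ex P (G j) - \prod_j Ex P (fun w => F j (X j w))) by rewrite EG; ring.
apply: le_trans (ler_normD _ _) _.
rewrite (_ : 2 * _ / _ = (size (index_enum I))%:R * K%:R^-1 +
  (size (index_enum I))%:R * K%:R^-1); last by ring.
apply: lerD.
  apply: Ex_dist_le => [||w]; [exact: bm_prod|exact: bm_prod|].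
  by apply: prod_dist_le => j; rewrite ?round_down_le1 ?round_down_dist.
apply: prod_dist_le => j.
- by apply: Ex_norm_le => // w; rewrite round_down_le1.
- by apply: Ex_norm_le.
- by apply: Ex_dist_le => // w; rewrite distrC round_down_dist.
Qed.

End IndependenceLaw.
(** * Characteristic function of a uniform unit vector *)

Section Dot.
Context {R : realType} {m : nat}.
Implicit Types (u v x : 'cV[R]_m).

Lemma dotC u v : dot u v = dot v u.
Proof. by apply: eq_bigr => i _; rewrite mulrC. Qed.

Lemma dotDl u v x : dot (u + v) x = dot u x + dot v x.
Proof. by rewrite -big_split; apply: eq_bigr => i _; rewrite !mxE mulrDl. Qed.

Lemma dotZl (a : R) u x : dot (a *: u) x = a * dot u x.
Proof. by rewrite mulr_sumr; apply: eq_bigr => i _; rewrite !mxE mulrA. Qed.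

Lemma dotNl u x : dot (- u) x = - dot u x.
Proof. by rewrite -scaleN1r dotZl mulN1r. Qed.

Lemma dotDr u v x : dot x (u + v) = dot x u + dot x v.
Proof. by rewrite dotC dotDl !(dotC _ x). Qed.

Lemma dotZr (a : R) u x : dot x (a *: u) = a * dot x u.
Proof. by rewrite dotC dotZl dotC. Qed.

Lemma dotNr u x : dot x (- u) = - dot x u.
Proof. by rewrite dotC dotNl dotC. Qed.

Definition dotE := (dotDl, dotDr, dotNl, dotNr, dotZl, dotZr).

Lemma dot0l x : dot 0 x = 0.
Proof. by rewrite /dot big1 // => i _; rewrite mxE mul0r. Qed.

Lemma dot_ge0 u : 0 <= dot u u.
Proof. by apply: sumr_ge0 => i _; rewrite -expr2 sqr_ge0. Qed.

Lemma dot_eq0 u : dot u u = 0 -> u = 0.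
Proof.
move=> /eqP; rewrite psumr_eq0 => [/allP u0|i _]; last by rewrite -expr2 sqr_ge0.
apply/matrixP => i j; rewrite ord1 mxE; apply/eqP.
by have := u0 i (mem_index_enum i); rewrite mulf_eq0 orbb.
Qed.

Definition unit_vec (i : 'I_m) : 'cV[R]_m := delta_mx i ord0.

Lemma dot_unit_vec i x : dot (unit_vec i) x = x i ord0.
Proof.
rewrite /dot (bigD1 i) //= big1 => [|j ji]; first by rewrite mxE !eqxx mul1r addr0.
by rewrite mxE (negbTE ji) mul0r.
Qed.

Lemma dot_unit_vecs i j : dot (unit_vec i) (unit_vec j) = (i == j)%:R.
Proof. by rewrite dot_unit_vec mxE eqxx andbT. Qed.

Lemma trmx_mul_dot u v : u^T *m v = (dot u v)%:M.
Proof.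
apply/matrixP => i j; rewrite !ord1 !mxE eqxx mulr1n.
by apply: eq_bigr => k _; rewrite mxE.
Qed.

(** Reflect in the hyperplane orthogonal to [u - v]. *)
Lemma reflection_exchange u v : dot u u = dot v v ->
  exists2 Q : 'M[R]_m, orthogonal_mx Q & forall x, dot u (Q *m x) = dot v x.
Proof.
move=> uv; have [->|uNv] := eqVneq u v.
  by exists 1%:M => [|x]; rewrite /orthogonal_mx ?trmx1 mul1mx.
pose a := u - v; pose c := 2 / dot a a.
have a0 : dot a a != 0.
  by apply: contra_neq uNv => /dot_eq0 /eqP; rewrite subr_eq0 => /eqP.
pose Q := 1%:M - c *: (a *m a^T).
have QE x : Q *m x = x - (c * dot a x) *: a.
  by rewrite mulmxBl mul1mx -scalemxAl -mulmxA trmx_mul_dot mul_mx_scalar scalerA.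
exists Q => [|x].
  have -> : orthogonal_mx Q = (Q *m Q = 1%:M).
    rewrite /orthogonal_mx; congr (_ *m _ = _); apply/matrixP => i j.
    rewrite !mxE eq_sym; congr (_ - _ * _); apply: eq_bigr => k _.
    by rewrite !mxE mulrC.
  rewrite {1}/Q mulmxBl mul1mx -scalemxAl -mulmxA.
  rewrite mulmxBr mulmx1 -scalemxAr mulmxA trmx_mul_dot mul_scalar_mx scalerA.
  have -> : c * dot a a = 2 by rewrite /c divfK.
  rewrite -{1}[a^T]scale1r -scalerBl -scalemxAr scalerA.
  rewrite (_ : c * (1 - 2) = - c); last by ring.
  by rewrite /Q scaleNr opprK subrK.
rewrite QE !dotE.
have -> : c * (dot u x - dot v x) * (dot u u - dot u v) = dot u x - dot v x.
  have -> : dot u u - dot u v = dot a a / 2 by rewrite /a !dotE -uv (dotC v u); field.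
  by rewrite /c mulrAC mulrA -[2 / _ * _]mulrA mulVf // mulr1 divff ?mul1r.
by rewrite opprB addrC subrK.
Qed.

End Dot.

Lemma measurable_dot (R : realType) m (u : 'cV[R]_m) :
  measurable_fun [set: borelV R m] (dot u).
Proof.
apply: measurable_sum => i; apply: measurable_funM; first exact: measurable_cst.
apply: (measurability _ (measurable_realfun.RGenOpens.measurableE R)).
move=> _ [_ [a [b ->]] <-]; rewrite setTI; apply: sub_sigma_algebra.
have := @coord_continuous R m 1 i ord0 => /continuousP; apply.
exact: interval_open.
Qed.

Section UniformVector.
Context {d : measure_display} {T : measurableType d} {R : realType} {m : nat}.
Variables (P : probability T R) (X : T -> borelV R m).

(** What the proof uses of a uniform random direction: unit length on every
    outcome and projections whose law depends only on the length of the
    vector projected on. *)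
Definition isotropic_unit_vector : Prop :=
  [/\ measurable_fun [set: T] X,
      forall w, dot (X w) (X w) = 1 &
      forall (u v : 'cV[R]_m) (B : set R), dot u u = dot v v -> measurable B ->
        P ((fun w => dot u (X w)) @^-1` B) = P ((fun w => dot v (X w)) @^-1` B)].

Hypothesis unifX : isotropic_unit_vector.
Implicit Types (u v : 'cV[R]_m) (F : R -> R).

Lemma measurable_dotX u : measurable_fun [set: T] (fun w => dot u (X w)).
Proof. by have [mX _ _] := unifX; apply: measurableT_comp mX; exact: measurable_dot. Qed.

Lemma coord_sqr_sum w : \sum_i (X w i ord0) ^+ 2 = 1.
Proof.
have [_ X1 _] := unifX; rewrite -(X1 w).
by apply: eq_bigr => i _; rewrite expr2.
Qed.

Lemma coord_le1 w i : `|X w i ord0| <= 1.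
Proof.
rewrite -(@expr_le1 _ 2) // real_normK ?num_real // -(coord_sqr_sum w).
by rewrite (bigD1 i) //= lerDl sumr_ge0 // => j _; exact: sqr_ge0.
Qed.

Lemma bm_dotX u : bounded_measurable (fun w => dot u (X w)).
Proof.
apply: bm_sum => i; apply: bmM; first exact: bm_cst.
split; last by exists 1 => w; exact: coord_le1.
by under eq_fun do rewrite -dot_unit_vec; exact: measurable_dotX.
Qed.

Lemma bmX (f : T -> R) k : bounded_measurable f ->
  bounded_measurable (fun w => f w ^+ k).
Proof.
move=> bf; elim: k => [|k IH]; first exact: (bm_cst 1).
by under eq_fun do rewrite exprS; exact: bmM.
Qed.

Lemma Ex_dot_law F u v : dot u u = dot v v -> measurable_fun [set: R] F ->
  bounded_measurable (fun w => F (dot u (X w))) ->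
  bounded_measurable (fun w => F (dot v (X w))) ->
  Ex P (fun w => F (dot u (X w))) = Ex P (fun w => F (dot v (X w))).
Proof.
move=> uv mF bu bv; apply: Ex_law => // B mB; have [_ _ inv] := unifX.
apply: (inv u v (F @^-1` B)) => //.
by rewrite -[X in measurable X]setTI; exact: mF.
Qed.

Lemma Ex_dotX_law k u v : dot u u = dot v v ->
  Ex P (fun w => dot u (X w) ^+ k) = Ex P (fun w => dot v (X w) ^+ k).
Proof.
move=> uv; apply: (@Ex_dot_law (fun x => x ^+ k)) => //; try exact/bmX/bm_dotX.
Qed.

Lemma Ex_cos_law u v : dot u u = dot v v ->
  Ex P (fun w => cos (dot u (X w))) = Ex P (fun w => cos (dot v (X w))).
Proof.
move=> uv; apply: (@Ex_dot_law cos) => //; try exact/bm_cos/measurable_dotX.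
by apply: continuous_measurable_fun; exact: continuous_cos.
Qed.

Section Moments.
Variables (i0 i1 : 'I_m).
Hypothesis i01 : i0 != i1.

Let m_neq0 : m%:R != 0 :> R.
Proof. by rewrite pnatr_eq0 -lt0n; apply: leq_ltn_trans (ltn_ord i0). Qed.

Let m_gt0 : 0 < m%:R :> R.
Proof. by rewrite lt0r m_neq0 /=. Qed.

Lemma Ex_dotX_scale k u :
  Ex P (fun w => dot u (X w) ^+ k) =
  Num.sqrt (dot u u) ^+ k * Ex P (fun w => dot (unit_vec i0) (X w) ^+ k).
Proof.
rewrite (@Ex_dotX_law k u (Num.sqrt (dot u u) *: unit_vec i0)); last first.
  by rewrite !dotE dot_unit_vecs eqxx mulr1 -expr2 sqr_sqrtr // dot_ge0.
rewrite -ExZ; last exact/bmX/bm_dotX.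
by congr (Ex P _); apply/funext => w; rewrite dotZl exprMn.
Qed.

Lemma Ex_dotX2 u : Ex P (fun w => dot u (X w) ^+ 2) = dot u u / m%:R.
Proof.
rewrite Ex_dotX_scale sqr_sqrtr ?dot_ge0 //; congr (_ * _).
set M2 := Ex P _.
have : \sum_(i < m) M2 = 1.
  transitivity (Ex P (fun w => \sum_i dot (unit_vec i) (X w) ^+ 2)).
    rewrite Ex_sum => [|i]; last exact/bmX/bm_dotX.
    by apply: eq_bigr => i _; apply: Ex_dotX_law; rewrite !dot_unit_vecs !eqxx.
  rewrite -[RHS](Ex_cst P 1); congr (Ex P _); apply/funext => w.
  by under eq_bigr do rewrite dot_unit_vec; exact: coord_sqr_sum.
rewrite sumr_const card_ord => H.
by apply: (mulfI m_neq0); rewrite mulr_natl H divff.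
Qed.

(** Rotating by 45 degrees in a coordinate plane expresses the mixed fourth
    moments through the pure one; both are then fixed by [(sum x_i^2)^2 = 1]. *)
Lemma Ex_dotX4 u :
  Ex P (fun w => dot u (X w) ^+ 4) <= 3 * (dot u u) ^+ 2 / m%:R ^+ 2.
Proof.
rewrite Ex_dotX_scale; set M4 := Ex P _.
rewrite (exprM _ 2 2) sqr_sqrtr ?dot_ge0 //.
rewrite [leRHS](_ : _ = dot u u ^+ 2 * (3 / m%:R ^+ 2)); last by ring.
rewrite ler_wpM2l ?sqr_ge0 //.
pose x i w : R := dot (unit_vec i) (X w).
have bx i : bounded_measurable (x i) by exact: bm_dotX.
have M4E i : Ex P (fun w => x i w ^+ 4) = M4.
  by apply: Ex_dotX_law; rewrite !dot_unit_vecs !eqxx.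
have mixed i j : i != j -> Ex P (fun w => x i w ^+ 2 * x j w ^+ 2) = M4 / 3.
  move=> ij.
  (* [unit_vec i + e *: unit_vec j] has length [sqrt 2] for [e = 1] and [e = -1]. *)
  have two (e : R) : e ^+ 2 = 1 -> Ex P (fun w => (x i w + e * x j w) ^+ 4) = 4 * M4.
    move=> e2; transitivity (Ex P (fun w => dot (unit_vec i + e *: unit_vec j) (X w) ^+ 4)).
      by congr (Ex P _); apply/funext => w; rewrite !dotE.
    rewrite Ex_dotX_scale (exprM _ 2 2) sqr_sqrtr ?dot_ge0 //.
    rewrite !dotE !dot_unit_vecs !eqxx (negbTE ij) eq_sym (negbTE ij) -/M4.
    rewrite /= (_ : _ + _ = 1 + e ^+ 2); last by ring.
    by rewrite e2; ring.
  have : Ex P (fun w => (x i w + 1 * x j w) ^+ 4 + (x i w + (- 1) * x j w) ^+ 4)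
    = 8 * M4.
    rewrite ExD; try (apply: bmX; apply: bmD => //; apply: bmM => //; exact: bm_cst).
    by rewrite !two ?sqrrN ?expr1n //; ring.
  have -> : (fun w => (x i w + 1 * x j w) ^+ 4 + (x i w + (- 1) * x j w) ^+ 4)
    = (fun w => 2 * x i w ^+ 4 + (12 * (x i w ^+ 2 * x j w ^+ 2) + 2 * x j w ^+ 4)).
    by apply/funext => w; ring.
  have b4 k : bounded_measurable (fun w => 2 * x k w ^+ 4).
    by apply: bmM; [exact: bm_cst|exact: bmX].
  have b22 : bounded_measurable (fun w => x i w ^+ 2 * x j w ^+ 2).
    by apply: bmM; exact: bmX.
  have b12 : bounded_measurable (fun w => 12 * (x i w ^+ 2 * x j w ^+ 2)).
    by apply: bmM => //; exact: bm_cst.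
  rewrite !ExD ?ExZ ?M4E //; try exact: bmX; last exact: bmD.
  lra.
have : \sum_(i < m) \sum_(j < m) (M4 / 3 + (i == j)%:R * (M4 * 2 / 3)) = 1.
  transitivity (Ex P (fun w => \sum_i \sum_j x i w ^+ 2 * x j w ^+ 2)).
    have b22 i j : bounded_measurable (fun w => x i w ^+ 2 * x j w ^+ 2).
      by apply: bmM; exact: bmX.
    rewrite Ex_sum => [|i]; last by apply: bm_sum => j.
    apply: eq_bigr => i _; rewrite Ex_sum //; apply: eq_bigr => j _.
    have [<-|ij] := eqVneq i j; last by rewrite mixed // mul0r addr0.
    rewrite -(M4E i) mul1r -mulrA -mulrDr (_ : _ + _ = 1) ?mulr1; last by field.
    by congr (Ex P _); apply/funext => w; rewrite -exprD.
  rewrite -[RHS](Ex_cst P 1); congr (Ex P _); apply/funext => w.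
  have x1 : \sum_i x i w ^+ 2 = 1.
    by rewrite -(coord_sqr_sum w); apply: eq_bigr => i _; rewrite /x dot_unit_vec.
  under eq_bigr do rewrite -mulr_sumr.
  by rewrite -mulr_suml x1 mulr1.
have inner (i : 'I_m) :
    \sum_(j < m) (M4 / 3 + (i == j)%:R * (M4 * 2 / 3)) = m%:R * (M4 / 3) + M4 * 2 / 3.
  rewrite big_split /= sumr_const card_ord mulr_natl; congr (_ + _).
  rewrite (bigD1 i) //= eqxx mul1r big1 ?addr0 // => j ji.
  by rewrite eq_sym (negbTE ji) mul0r.
under eq_bigr do rewrite inner.
rewrite sumr_const card_ord => H.
have M40 : 0 <= M4.
  rewrite -(Ex_cst P 0); apply: Ex_le; [exact: bm_cst|exact/bmX/bm_dotX|move=> w].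
  by rewrite (exprM _ 2 2) sqr_ge0.
rewrite ler_pdivlMr; last exact: exprn_gt0.
have : 0 <= m%:R * M4 by apply: mulr_ge0.
by lra.
Qed.

(** The characteristic function of [X], real because the law is symmetric. *)
Definition phi u : R := Ex P (fun w => cos (dot u (X w))).

Lemma phi_ge u : 1 - dot u u / (2 * m%:R) <= phi u.
Proof.
have bd : bounded_measurable (fun w => - 2^-1 * dot u (X w) ^+ 2).
  by apply: bmM; [exact: bm_cst|exact/bmX/bm_dotX].
apply: le_trans (_ : _ <= Ex P (fun w => 1 + - 2^-1 * dot u (X w) ^+ 2)) _.
  rewrite ExD ?Ex_cst ?ExZ ?Ex_dotX2 //; try exact: bm_cst; last exact/bmX/bm_dotX.
  by rewrite invfM; lra.
apply: Ex_le; [by apply: bmD => //; exact: bm_cst|exact/bm_cos/measurable_dotX|].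
by move=> w; have := cos_ge (dot u (X w)); lra.
Qed.

Lemma phi_le u :
  phi u <= 1 - dot u u / (2 * m%:R) + (dot u u) ^+ 2 / (8 * m%:R ^+ 2).
Proof.
have bd : bounded_measurable (fun w => - 2^-1 * dot u (X w) ^+ 2).
  by apply: bmM; [exact: bm_cst|exact/bmX/bm_dotX].
have b4 : bounded_measurable (fun w => 24^-1 * dot u (X w) ^+ 4).
  by apply: bmM; [exact: bm_cst|exact/bmX/bm_dotX].
have b2 : bounded_measurable (fun w => 1 + - 2^-1 * dot u (X w) ^+ 2).
  by apply: bmD => //; exact: bm_cst.
apply: (@le_trans _ _ (Ex P (fun w =>
    1 + - 2^-1 * dot u (X w) ^+ 2 + 24^-1 * dot u (X w) ^+ 4))).
  apply: Ex_le; [exact/bm_cos/measurable_dotX|exact: bmD|].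
  by move=> w; have := cos_le (dot u (X w)); lra.
rewrite !ExD ?Ex_cst ?ExZ ?Ex_dotX2 //; try exact: bm_cst; try exact/bmX/bm_dotX.
by have := Ex_dotX4 u; rewrite !invfM; lra.
Qed.

Lemma Ex_cos_cos u v :
  Ex P (fun w => cos (dot u (X w)) * cos (dot v (X w))) = (phi (u + v) + phi (u - v)) / 2.
Proof.
rewrite -ExD; try exact/bm_cos/measurable_dotX.
rewrite mulrC -ExZ; last by apply: bmD; exact/bm_cos/measurable_dotX.
congr (Ex P _); apply/funext => w; rewrite !dotE cosD cosB; lra.
Qed.

(** Writing a frequency of length at least one as [b e0 + e1] or [b e0 - e1]
    after a rotation, one averages to [cos (b x0) cos x1]; this is at most
    [cos x1] in absolute value, since [x1] is at most one. *)
Lemma phi_far u : (1 < m)%N -> 1 <= dot u u -> `|phi u| <= 1 - 1 / (4 * m%:R).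
Proof.
move=> m1 u1; pose b := Num.sqrt (dot u u - 1).
have b2 : b * b = dot u u - 1 by rewrite -expr2 sqr_sqrtr //; lra.
pose e0 := b *: unit_vec i0; pose e1 : 'cV[R]_m := unit_vec i1.
have i01F := negbTE i01; have i10F : (i1 == i0) = false by rewrite eq_sym.
have dotp : dot u u = dot (e0 + e1) (e0 + e1).
  by rewrite /e0 /e1 !dotE !dot_unit_vecs !eqxx i01F i10F /=; lra.
have dotm : dot u u = dot (e0 - e1) (e0 - e1).
  by rewrite /e0 /e1 !dotE !dot_unit_vecs !eqxx i01F i10F /=; lra.
have -> : phi u = Ex P (fun w => cos (dot e0 (X w)) * cos (dot e1 (X w))).
  rewrite Ex_cos_cos /phi -(Ex_cos_law dotp) -(Ex_cos_law dotm); lra.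
have bc v : bounded_measurable (fun w => cos (dot v (X w))).
  exact/bm_cos/measurable_dotX.
have e1E : dot e1 e1 = 1 by rewrite dot_unit_vecs eqxx.
have : phi e1 <= 1 - 1 / (4 * m%:R).
  apply: le_trans (phi_le _) _; rewrite e1E expr1n.
  rewrite -subr_ge0.
  rewrite (_ : _ - _ = (m%:R - 2^-1) / (4 * m%:R ^+ 2)); last by field.
  apply: divr_ge0; last by rewrite mulr_ge0 // sqr_ge0.
  have : 1 < m%:R :> R by rewrite ltr1n.
  by lra.
move=> pe1; apply: le_trans pe1; rewrite ler_norml.
have key w : `|cos (dot e0 (X w)) * cos (dot e1 (X w))| <= cos (dot e1 (X w)).
  have c1 : 0 <= cos (dot e1 (X w)).
    by apply: cos_ge0_unit; rewrite dot_unit_vec coord_le1.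
  by rewrite normrM (ger0_norm c1) ler_piMl // cos_max.
have bb : bounded_measurable (fun w => cos (dot e0 (X w)) * cos (dot e1 (X w))).
  exact: bmM.
apply/andP; split; last first.
  by apply: Ex_le => // w; have := key w; rewrite ler_norml => /andP[].
rewrite -mulN1r -ExZ //; apply: Ex_le => // [|w].
  by apply: bmM => //; exact: bm_cst.
by have := key w; rewrite ler_norml mulN1r => /andP[].
Qed.

Let Tf u v : R := Ex P (fun w => cos (dot u (X w)) * cos (dot v (X w))).
Let parallelogram u v :
  dot (u + v) (u + v) + dot (u - v) (u - v) = 2 * (dot u u + dot v v).
Proof. by rewrite !dotE (dotC v u); ring. Qed.

Lemma Ex_cos_cos_ge u v : 1 - (dot u u + dot v v) / (2 * m%:R) <= Tf u v.
Proof.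
rewrite /Tf Ex_cos_cos; have := phi_ge (u + v); have := phi_ge (u - v).
have -> : dot (u - v) (u - v) = 2 * (dot u u + dot v v) - dot (u + v) (u + v).
  by have := parallelogram u v; lra.
by rewrite invfM; lra.
Qed.

(** The squared lengths of [u + v] and [u - v] have sum [2 (|u|^2 + |v|^2)],
    so their squares sum to at most [4 (|u|^2 + |v|^2)^2]. *)
Lemma Ex_cos_cos_le u v :
  Tf u v <= 1 - (dot u u + dot v v) / (2 * m%:R)
              + (dot u u + dot v v) ^+ 2 / (4 * m%:R ^+ 2).
Proof.
rewrite /Tf Ex_cos_cos; have := phi_le (u + v); have := phi_le (u - v).
have := parallelogram u v.
move: (dot_ge0 (u + v)) (dot_ge0 (u - v)).
set a := dot (u + v) _; set b := dot (u - v) _; set q := dot u u + _.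
move=> a0 b0 abq; rewrite !invfM.
have i0' : 0 <= m%:R ^- 2 :> R by rewrite invr_ge0 sqr_ge0.
have ab : 0 <= (4 * q ^+ 2 - a ^+ 2 - b ^+ 2) * m%:R ^- 2.
  apply: mulr_ge0 => //; rewrite (_ : q = (a + b) / 2); last by lra.
  by have := mulr_ge0 a0 b0; lra.
by have bE : b = 2 * q - a by [lra]; move: ab; rewrite bE; lra.
Qed.

(** One of [u + v] and [u - v] has length at least one. *)
Lemma Ex_cos_cos_far u v : (1 < m)%N -> 1 <= dot u u + dot v v ->
  `|Tf u v| <= 1 - 1 / (8 * m%:R).
Proof.
move=> m1 far; rewrite /Tf Ex_cos_cos.
have le1 x : `|phi x| <= 1.
  apply: Ex_norm_le => [|w]; first exact/bm_cos/measurable_dotX.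
  exact: cos_max.
rewrite normrM [`|2^-1|]ger0_norm // ler_pdivrMr //.
apply: le_trans (ler_normD _ _) _; rewrite invfM.
have := le1 (u + v); have := le1 (u - v).
have [/(phi_far m1)|pfar] := leP 1 (dot (u + v) (u + v)).
  by rewrite invfM; lra.
have /(phi_far m1) : 1 <= dot (u - v) (u - v) by have := parallelogram u v; lra.
by rewrite invfM; lra.
Qed.

End Moments.
End UniformVector.
(** * Heat sums over the binomial frequencies *)

Section BinomialHeat.
Context {R : realType}.
Variable q : nat.
Local Notation freq_index := ('I_(2 * q).+1).
Implicit Types (k : freq_index) (c : R).

Lemma bin_le_succ k : (k < q)%N -> ('C(2 * q, k) <= 'C(2 * q, k.+1))%N.
Proof.
move=> kq; rewrite -(leq_pmul2l (ltn0Sn k)) mul_bin_left leq_mul2r.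
by apply/orP; right; lia.
Qed.

Lemma bin_le_mid (a b : nat) : (a <= b <= q)%N -> ('C(2 * q, a) <= 'C(2 * q, b))%N.
Proof.
move=> /andP[ab bq]; elim: b ab bq => [|b IH]; first by rewrite leqn0 => /eqP->.
rewrite leq_eqVlt => /orP[/eqP->//|ab] bq.
apply: leq_trans (IH ab (ltnW bq)) _.
have bb : (b < (2 * q).+1)%N by lia.
exact: (@bin_le_succ (Ordinal bb)).
Qed.

(** The distance to the centre [q] is halved and rounded down, which moves
    towards the mode of the binomial law. *)
Definition halve_nat (k : nat) : nat :=
  if (q <= k)%N then (q + (k - q)./2)%N else (q - (q - k)./2)%N.

Lemma halve_subproof k : (halve_nat k < (2 * q).+1)%N.
Proof. by rewrite /halve_nat; have := ltn_ord k; case: (leqP q k); lia. Qed.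

Definition halve k : freq_index := Ordinal (halve_subproof k).

Lemma bin_le_halve k : ('C(2 * q, k) <= 'C(2 * q, halve k))%N.
Proof.
rewrite /= /halve_nat; have kq := ltn_ord k; case: (leqP q k) => qk.
  rewrite -bin_sub; last by lia.
  rewrite -[X in (_ <= X)%N]bin_sub; last by lia.
  by apply: bin_le_mid; lia.
by apply: bin_le_mid; lia.
Qed.

Lemma freq_halve k : freq (halve k) ^+ 2 <= freq k ^+ 2 / 4 :> R.
Proof.
rewrite /freq !exprMn ler_pdivlMr // [2 ^+ 2 * _ * 4]mulrAC -mulrA.
rewrite ler_pM2l ?exprn_gt0 // /= /halve_nat.
have -> : 4 = 2 ^+ 2 :> R by ring.
rewrite -exprMn -(real_normK (num_real (2 * _))) -(real_normK (num_real (_ - _))).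
rewrite lerXn2r ?nnegrE //; case: (leqP q k) => qk.
  rewrite natrD addrAC subrr add0r -natrB // ger0_norm ?mulr_ge0 // ger0_norm //.
  by rewrite -natrM ler_nat; lia.
rewrite natrB; last by lia.
rewrite addrAC subrr add0r mulrN normrN -opprB normrN -natrB 1?ltnW //.
by rewrite !ger0_norm ?mulr_ge0 // -natrM ler_nat; lia.
Qed.

Lemma card_halve_fibre (l : freq_index) : (#|[pred k | halve k == l]| <= 4)%N.
Proof.
rewrite -[X in (_ <= X)%N]card_ord.
(* Preimages of [l] lie in [2 l - q - 1, 2 l - q + 1]. *)
pose f k : 'I_4 := inord (k + q + 1 - 2 * l).
apply: (@leq_card_in _ _ f) => k1 k2; rewrite !inE => /eqP e1 /eqP e2.
have {}e1 : halve_nat k1 = l by rewrite -e1.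
have {}e2 : halve_nat k2 = l by rewrite -e2.
move=> /(congr1 val); rewrite /= !inordK => [e||].
all: move: e1 e2; rewrite /halve_nat; have := ltn_ord k1; have := ltn_ord k2.
all: case: (leqP q k1); case: (leqP q k2); try lia.
all: by move=> *; apply: val_inj => /=; lia.
Qed.

(** A Gaussian of the frequency averaged against the binomial law; the width
    of the Gaussian is [1 / sqrt c]. *)
Definition heat1 c : R := \sum_(k : freq_index) coef k * expR (- (c * freq k ^+ 2)).

(** The map [halve] increases the weight, divides the squared frequency by at
    least four and is at most four-to-one. *)
Lemma heat1_doubling c : 0 <= c -> heat1 (c / 4) <= 4 * heat1 c.
Proof.
move=> c0; pose g k : R := coef k * expR (- (c * freq k ^+ 2)).
have g0 k : 0 <= g k by rewrite mulr_ge0 ?coef_ge0 ?expR_ge0.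
apply: (@le_trans _ _ (\sum_k g (halve k))).
  apply: ler_sum => k _; apply: ler_pM; rewrite ?coef_ge0 ?expR_ge0 //.
    by rewrite /coef ler_wpM2r ?invr_ge0 ?exprn_ge0 // ler_nat bin_le_halve.
  rewrite ler_expR lerN2 -mulrA [_^-1 * _]mulrC ler_wpM2l //.
  exact: freq_halve.
rewrite (partition_big halve xpredT) //= /heat1 mulr_sumr; apply: ler_sum => l _.
rewrite (eq_bigr (fun=> g l)) => [|k /eqP-> //].
by rewrite sumr_const -[leLHS]mulr_natl -/(g l) ler_wpM2r // ler_nat card_halve_fibre.
Qed.

(** The central frequency is zero and has the largest of the [2 q + 1]
    weights, which add up to one. *)
Lemma heat1_ge c : (2 * q).+1%:R^-1 <= heat1 c.
Proof.
have qq : (q < (2 * q).+1)%N by lia.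
pose k0 : freq_index := Ordinal qq.
apply: (@le_trans _ _ (coef k0)).
  rewrite -div1r ler_pdivrMr // -[leLHS](@sum_coef R q) mulr_natr.
  rewrite -[X in _ *+ X]card_ord -sumr_const; apply: ler_sum => k _.
  rewrite /coef ler_wpM2r ?invr_ge0 ?exprn_ge0 // ler_nat /=.
  have [kq|qk] := leqP k q; first by apply: bin_le_mid; rewrite kq leqnn.
  rewrite -bin_sub; last by have := ltn_ord k; lia.
  by apply: bin_le_mid; lia.
have f0 : freq k0 = 0 :> R by rewrite /freq subrr mulr0.
rewrite /heat1 (bigD1 k0) //= f0 expr0n /= mulr0 oppr0 expR0 mulr1.
by rewrite lerDl sumr_ge0 // => k _; rewrite mulr_ge0 ?coef_ge0 ?expR_ge0.
Qed.

End BinomialHeat.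

Section Heat.
Context {R : realType}.
Variables (m q : nat) (h : R).

Definition heat (B : R) : R :=
  \sum_(k : {ffun 'I_m -> 'I_(2 * q).+1})
    weight k * expR (- (B * dot (theta h k) (theta h k))).

Lemma heatE B : heat B = heat1 q (B * h ^+ 2) ^+ m.
Proof.
rewrite -[X in _ ^+ X](card_ord m) -prodr_const /heat1.
rewrite bigA_distr_bigA /=; apply: eq_bigr => k _.
rewrite big_split /= -expR_sum; congr (_ * expR _).
rewrite sumrN mulr_sumr; congr (- _); apply: eq_bigr => i _.
by rewrite !mxE; ring.
Qed.

Lemma heat_doubling B : 0 <= B -> heat (B / 4) <= 4 ^+ m * heat B.
Proof.
move=> B0; rewrite !heatE -exprMn.
have p c : 0 <= heat1 q c :> R by apply: le_trans (heat1_ge q c); rewrite invr_ge0.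
rewrite lerXn2r ?nnegrE ?mulr_ge0 // mulrAC.
by apply: heat1_doubling; rewrite mulr_ge0 ?sqr_ge0.
Qed.

Lemma heat_ge B : (2 * q).+1%:R ^- m <= heat B.
Proof.
rewrite heatE -exprVn lerXn2r ?nnegrE ?invr_ge0 ?heat1_ge //.
by apply: le_trans (heat1_ge q _); rewrite invr_ge0.
Qed.

End Heat.

(** * The second moment in frequency space *)

(** Here [w] is the law of the frequencies, [N] their squared length, [a] and
    [t] the factors that column [j] contributes to the first and the second
    moment. *)
Section SecondMoment.
Context {R : realType} {K : finType}.
Variables (m n : nat) (w N : K -> R) (a : 'I_n -> K -> R) (t : 'I_n -> K -> K -> R).
Variable tau : R.
Hypothesis m_gt1 : (1 < m)%N.
Hypothesis w_ge0 : forall k, 0 <= w k.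
Hypothesis w_sum : \sum_k w k = 1.
Hypothesis N_ge0 : forall k, 0 <= N k.
Hypothesis tau_bounds : 0 <= tau <= 1 / 2.
Hypothesis a_ge : forall j k, 1 - N k / (2 * m%:R) <= a j k.
Hypothesis a_le : forall j k,
  a j k <= 1 - N k / (2 * m%:R) + N k ^+ 2 / (4 * m%:R ^+ 2).
Hypothesis a_far : forall j k, 1 <= N k -> `|a j k| <= 1 - 1 / (8 * m%:R).
Hypothesis t_ge : forall j k l, 1 - (N k + N l) / (2 * m%:R) <= t j k l.
Hypothesis t_le : forall j k l,
  t j k l <= 1 - (N k + N l) / (2 * m%:R) + (N k + N l) ^+ 2 / (4 * m%:R ^+ 2).
Hypothesis t_far : forall j k l,
  1 <= N k + N l -> `|t j k l| <= 1 - 1 / (8 * m%:R).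

Let A : R := n%:R / m%:R.
Definition heat_sum (B : R) : R := \sum_k w k * expR (- (B * N k)).
Definition near k := N k <= tau.

Definition main_term : R := \sum_(k | near k) w k * \prod_j a j k.
(** Bounds for the parts of the two moments where some frequency is above
    [tau]: a Gaussian term for the medium range and a constant for the far
    range. *)
Definition tail1 : R := expR (- (A * tau / 8)) * heat_sum (A / 4) + expR (- (A / 8)).
Definition tail2 : R := expR (- (A * tau / 8)) * heat_sum (A / 4) ^+ 2 + expR (- (A / 8)).

Let mR : 0 < m%:R :> R. Proof. by rewrite ltr0n ltnW. Qed.
Let mR2 : 2 <= m%:R :> R. Proof. by rewrite ler_nat. Qed.
Let A_ge0 : 0 <= A. Proof. by rewrite divr_ge0. Qed.

(** Off the low frequencies each factor is bounded either by a Gaussian or,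
    once [Q] exceeds one, by a constant below one. *)
Lemma prod_tail (f : 'I_n -> R) (Q : R) : tau < Q ->
  (forall j, 1 - Q / (2 * m%:R) <= f j) ->
  (forall j, f j <= 1 - Q / (2 * m%:R) + Q ^+ 2 / (4 * m%:R ^+ 2)) ->
  (1 <= Q -> forall j, `|f j| <= 1 - 1 / (8 * m%:R)) ->
  `|\prod_j f j| <=
    expR (- (A * tau / 8)) * expR (- (A / 4 * Q)) + expR (- (A / 8)).
Proof.
move=> tQ fge fle ffar; case/andP: tau_bounds => t0 t1.
have prodE (b : R) : (forall j, `|f j| <= 1 - b) -> `|\prod_j f j| <= expR (- (n%:R * b)).
  move=> fb; rewrite normr_prod.
  case: n f fb {fge fle ffar} => [|n'] f fb.
    by rewrite big_ord0 mul0r oppr0 expR0.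
  have b1 : 0 <= 1 - b by apply: le_trans (fb ord0).
  apply: (@le_trans _ _ ((1 - b) ^+ n'.+1)); last exact: expr_le_expR.
  rewrite -[X in _ ^+ X]card_ord -prodr_const; apply: ler_prod => j _.
  by rewrite normr_ge0 fb.
have [Q1|Q1] := leP 1 Q.
  apply: le_trans (prodE _ (ffar Q1)) _.
  rewrite ler_wpDl ?mulr_ge0 ?expR_ge0 // ler_expR lerN2 /A.
  by rewrite le_eqVlt; apply/orP; left; apply/eqP; field; rewrite gt_eqF.
rewrite ler_wpDr ?expR_ge0 // -expRD.
apply: le_trans (prodE (3 / 8 * Q / m%:R) _) _.
  move=> j; have i0 : 0 < m%:R^-1 :> R by rewrite invr_gt0.
  have i1 : m%:R^-1 <= 1 / 2 :> R.
    by rewrite -div1r ler_pdivrMr //; have := mR2; lra.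
  have := fge j; have := fle j.
  have -> : (2 * m%:R)^-1 = m%:R^-1 / 2 :> R by rewrite invfM mulrC.
  have -> : (4 * m%:R ^+ 2)^-1 = m%:R^-1 ^+ 2 / 4 :> R by rewrite invfM exprVn mulrC.
  move: i0 i1; set y := m%:R^-1 => i0 i1 h1 h2.
  have Q0 : 0 < Q by lra.
  have Qy : 0 < Q * y by rewrite mulr_gt0.
  have Qy1 : Q * y <= 1 / 2.
    by apply: le_trans i1; rewrite ler_piMl ?ltW.
  rewrite ger0_norm; last by lra.
  have : (Q * y) ^+ 2 <= (Q * y) * (1 / 2) by rewrite expr2 ler_wpM2l // ltW.
  rewrite exprMn; lra.
rewrite ler_expR; set x := n%:R * _.
have -> : x = 3 / 8 * (A * Q) by rewrite /x /A; ring.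
have : A * tau <= A * Q by rewrite ler_wpM2l // ltW.
lra.
Qed.

Lemma prod_a_tail k : ~~ near k ->
  `|\prod_j a j k| <=
    expR (- (A * tau / 8)) * expR (- (A / 4 * N k)) + expR (- (A / 8)).
Proof.
rewrite -ltNge => tN; apply: prod_tail => // Q1 j; exact: a_far.
Qed.

Lemma prod_t_tail k l : ~~ (near k && near l) ->
  `|\prod_j t j k l| <=
    expR (- (A * tau / 8)) * (expR (- (A / 4 * N k)) * expR (- (A / 4 * N l)))
    + expR (- (A / 8)).
Proof.
move=> nn; rewrite -expRD -opprD -mulrDr.
apply: prod_tail => // [|Q1 j]; last exact: t_far.
have := N_ge0 k; have := N_ge0 l; case/nandP: nn; rewrite -ltNge; lra.
Qed.

(** [n] times a bound for the relative error per column in replacing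
    [t j k l] by [a j k * a j l]. *)
Definition gap : R := n%:R * (2 * tau ^+ 2 / m%:R ^+ 2).

Lemma near_le1 k : near k -> N k / (2 * m%:R) <= 1 / 8.
Proof.
rewrite /near => kt; case/andP: tau_bounds => t0 t1.
rewrite ler_pdivrMr ?mulr_gt0 //; have := mR2; lra.
Qed.

Lemma a_near_gt0 j k : near k -> 0 < a j k.
Proof. by move=> /near_le1; have := a_ge j k; lra. Qed.

(** Both [t j k l] and [a j k * a j l] are [1 - (N k + N l) / (2 m)] up to
    second order in [tau / m]. *)
Lemma prod_t_near k l : near k -> near l ->
  \prod_j t j k l <= expR gap * (\prod_j a j k * \prod_j a j l).
Proof.
move=> nk nl; rewrite /gap expRM_natl -[X in _ ^+ X]card_ord -prodr_const.
rewrite -!big_split /=; apply: ler_prod => j _.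
have k8 := near_le1 nk; have l8 := near_le1 nl.
have tge := t_ge j k l; have tle := t_le j k l.
have ak := a_ge j k; have al := a_ge j l.
case/andP: tau_bounds => t0 t1.
have sq : (N k + N l) ^+ 2 / (4 * m%:R ^+ 2) <= tau ^+ 2 / m%:R ^+ 2.
  rewrite invfM mulrA ler_wpM2r ?invr_ge0 ?sqr_ge0 //.
  have : (N k + N l) ^+ 2 <= (2 * tau) ^+ 2.
    rewrite lerXn2r ?nnegrE ?addr_ge0 //; first lra.
    by move: nk nl; rewrite /near; lra.
  by rewrite exprMn; lra.
rewrite mulrDl in tge tle.
set x := N k / _ in k8 ak tge tle; set y := N l / _ in l8 al tge tle.
have x0 : 0 <= x by rewrite divr_ge0 // mulr_ge0.
have y0 : 0 <= y by rewrite divr_ge0 // mulr_ge0.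
apply/andP; split; first lra.
set z := tau ^+ 2 / _ in sq.
have z0 : 0 <= z by rewrite divr_ge0 ?sqr_ge0.
have aa : (1 - x) * (1 - y) <= a j k * a j l by apply: ler_pM; lra.
have e1 : 1 + 2 * z <= expR (2 * tau ^+ 2 / m%:R ^+ 2).
  by rewrite -mulrA; exact: expR_ge1Dx.
have xy : 0 <= x * y by rewrite mulr_ge0.
have aa2 : 1 / 2 <= a j k * a j l by lra.
have : 0 <= (expR (2 * tau ^+ 2 / m%:R ^+ 2) - (1 + 2 * z)) * (a j k * a j l).
  by apply: mulr_ge0; lra.
have : 0 <= z * (a j k * a j l - 1 / 2) by apply: mulr_ge0; lra.
lra.
Qed.

Lemma main_term_ge0 : 0 <= main_term.
Proof.
apply: sumr_ge0 => k nk; apply: mulr_ge0 => //; apply: prodr_ge0 => j _.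
by rewrite ltW // a_near_gt0.
Qed.

(** Below [tau] each factor is at least [1 - x >= exp (- 2 x)], so the main
    term dominates the low part of a Gaussian sum; the high part of that sum
    is compared with a Gaussian twice as wide. *)
Lemma main_term_ge : heat_sum A - expR (- (3 * A * tau / 4)) * heat_sum (A / 4)
  <= main_term.
Proof.
rewrite lerBlDr {1}/heat_sum (bigID near) /=; apply: lerD.
  apply: ler_sum => k nk; apply: ler_wpM2l => //.
  have -> : A * N k = n%:R * (2 * (N k / (2 * m%:R))).
    by rewrite /A; field; rewrite gt_eqF.
  rewrite -mulrN expRM_natl -[X in _ ^+ X]card_ord -prodr_const.
  apply: ler_prod => j _; rewrite expR_ge0 /=.
  apply: le_trans (a_ge j k); apply: expR_le_1sub.
  by rewrite divr_ge0 ?mulr_ge0 //; have := near_le1 nk; lra.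
apply: (@le_trans _ _ (\sum_(k | ~~ near k)
    expR (- (3 * A * tau / 4)) * (w k * expR (- (A / 4 * N k))))).
  apply: ler_sum => k; rewrite -ltNge => tN.
  rewrite mulrCA ler_wpM2l // -expRD ler_expR.
  have : A * tau <= A * N k by rewrite ler_wpM2l // ltW.
  lra.
rewrite -mulr_sumr ler_wpM2l ?expR_ge0 // [leRHS](bigID near) /=.
by rewrite lerDr sumr_ge0 // => k _; rewrite mulr_ge0 ?expR_ge0.
Qed.

Lemma first_moment_ge : main_term - tail1 <= \sum_k w k * \prod_j a j k.
Proof.
rewrite [leRHS](bigID near) /= lerD2l lerNl -sumrN.
apply: (@le_trans _ _ (\sum_k w k * (expR (- (A * tau / 8)) * expR (- (A / 4 * N k))
    + expR (- (A / 8))))); last first.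
  rewrite /tail1 /heat_sum mulr_sumr.
  under eq_bigr do rewrite mulrDr.
  rewrite big_split /= -mulr_suml w_sum mul1r lerD2r.
  by apply: ler_sum => k _; rewrite mulrCA.
rewrite [leRHS](bigID near) /= ler_wpDl //.
  by apply: sumr_ge0 => k _; rewrite mulr_ge0 // addr_ge0 ?mulr_ge0 ?expR_ge0.
apply: ler_sum => k nk; rewrite -mulrN ler_wpM2l //.
by apply: le_trans (prod_a_tail nk); rewrite ler_normr lexx orbT.
Qed.

Lemma second_moment_le :
  \sum_k \sum_l w k * w l * \prod_j t j k l <= expR gap * main_term ^+ 2 + tail2.
Proof.
pose u k := if near k then w k * \prod_j a j k else 0.
have uE : main_term = \sum_k u k by rewrite /main_term big_mkcond.
have u0 k : 0 <= u k.
  rewrite /u; case: ifP => // nk; apply: mulr_ge0 => //.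
  by apply: prodr_ge0 => j _; rewrite ltW // a_near_gt0.
pose g k := w k * expR (- (A / 4 * N k)).
have g0 k : 0 <= g k by rewrite mulr_ge0 ?expR_ge0.
have -> : expR gap * main_term ^+ 2 + tail2 = \sum_k \sum_l
   (expR gap * (u k * u l) + (expR (- (A * tau / 8)) * (g k * g l) +
      w k * w l * expR (- (A / 8)))).
  under [RHS]eq_bigr do rewrite !big_split /= -!mulr_sumr -mulr_suml -mulr_sumr w_sum.
  rewrite !big_split /= -!mulr_sumr -!mulr_suml -uE w_sum mulr1 mul1r.
  by rewrite /tail2 !expr2.
apply: ler_sum => k _; apply: ler_sum => l _.
have ww : 0 <= w k * w l by rewrite mulr_ge0.
have e0 x := @expR_ge0 R x.
have [/andP[nk nl]|nn] := boolP (near k && near l).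
  rewrite ler_wpDr ?addr_ge0 ?mulr_ge0 // /u nk nl.
  apply: le_trans (ler_wpM2l ww (prod_t_near nk nl)) _.
  by rewrite le_eqVlt; apply/orP; left; apply/eqP; ring.
rewrite ler_wpDl ?mulr_ge0 //.
apply: (@le_trans _ _ (w k * w l * `|\prod_j t j k l|)).
  by rewrite ler_wpM2l // ler_norm.
apply: le_trans (ler_wpM2l ww (prod_t_tail nn)) _.
by rewrite le_eqVlt; apply/orP; left; apply/eqP; rewrite /g; ring.
Qed.

(** Centring at the constant [main_term] instead of the mean makes an upper
    bound for the second moment and a lower bound for the first sufficient. *)
Lemma deviation_le :
  \sum_k \sum_l w k * w l * \prod_j t j k l
  - 2 * main_term * (\sum_k w k * \prod_j a j k) + main_term ^+ 2
  <= (expR gap - 1) * main_term ^+ 2 + tail2 + 2 * main_term * tail1.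
Proof.
have G0 : 0 <= 2 * main_term by rewrite mulr_ge0 // main_term_ge0.
have := ler_wpM2l G0 first_moment_ge; have := second_moment_le; lra.
Qed.

End SecondMoment.
(** * From moments to discrepancy *)

Section Discrepancy.
Context {R : realType} {m n : nat}.
Implicit Types (M : 'M[R]_(m, n)) (e : R).

Lemma norm_colP (u : 'cV[R]_m) e : 0 <= e ->
  reflect (forall i, `|u i ord0| <= e) (`|u| <= e).
Proof.
move=> e0; rewrite -[`|u|]/(mx_norm u) mx_normrE.
apply: (iffP (bigmax_leP _ _ _ _)) => [[_ H] i|H].
  exact: (H (i, ord0)).
by split=> // -[i j] _ /=; rewrite (ord1 j).
Qed.

Lemma disc_leP M e : 0 <= e ->
  disc M <= e <-> exists s, forall i, `|(M *m signing s) i ord0| <= e.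
Proof.
move=> e0; rewrite /disc; split.
  by move=> /bigmin_leP[|[s _]] /(norm_colP _ e0) H; [exists [ffun=> false]|exists s].
by move=> [s H]; apply/bigmin_leP; right; exists s => //; exact/norm_colP.
Qed.

Lemma signed_sum_le M s i : (forall j, dot (col j M) (col j M) = 1) ->
  `|(M *m signing s) i ord0| <= n%:R.
Proof.
move=> M1; rewrite mxE; apply: le_trans (ler_norm_sum _ _ _) _.
rewrite -[n in leRHS]card_ord -sumr_const; apply: ler_sum => j _.
rewrite mxE normrM normrX normrN1 expr1n mulr1.
rewrite -(@expr_le1 _ 2) // real_normK ?num_real // -(M1 j) /dot (bigD1 i) //=.
by rewrite !mxE -expr2 lerDl sumr_ge0 // => k _; rewrite -expr2 sqr_ge0.
Qed.

End Discrepancy.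

Section MeasurableDiscrepancy.
Context {d : measure_display} {T : measurableType d} {R : realType} {m n : nat}.
Variable M : T -> 'M[R]_(m, n).
Hypothesis mM : forall j, measurable_fun [set: T] (column M j).

Lemma measurable_entry i j : measurable_fun [set: T] (fun w => M w i j).
Proof.
rewrite (_ : (fun w => _) = dot (unit_vec i) \o column M j).
  by apply: measurableT_comp (measurable_dot _) (mM j).
by apply/funext => w /=; rewrite dot_unit_vec mxE.
Qed.

Lemma measurable_disc_le (e : R) : 0 <= e -> measurable [set w | disc (M w) <= e].
Proof.
move=> e0; have -> : [set w | disc (M w) <= e] =
    \bigcup_(s in [set: {ffun 'I_n -> bool}])
      \bigcap_(i in [set: 'I_m]) [set w | `|(M w *m signing s) i ord0| <= e].
  apply/seteqP; split => w /=.
    by move=> /(disc_leP _ e0)[s H]; exists s => // i _; exact: H.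
  by move=> [s _ H]; apply/(disc_leP _ e0); exists s => i; exact: H.
apply: fin_bigcup_measurable => // s _; apply: fin_bigcap_measurable => // i _.
rewrite -[X in measurable X]setTI; apply: measurable_fun_le => //.
apply: measurableT_comp; first exact: normr_measurable.
under eq_fun do rewrite mxE.
apply: measurable_sum => j; apply: measurable_funM => //.
exact: measurable_entry.
Qed.

End MeasurableDiscrepancy.

Section DiscrepancyProbability.
Context {d : measure_display} {T : measurableType d} {R : realType} {m n : nat}.
Variables (P : probability T R) (M : T -> 'M[R]_(m, n)).
Hypothesis unifM : forall j, isotropic_unit_vector P (column M j).
Hypothesis indepM : mutually_independent P (column M).

Section Frequencies.
Variables (q : nat) (h tau : R).
Hypothesis m_gt1 : (1 < m)%N.
Hypothesis tau_bounds : 0 <= tau <= 1 / 2.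
Local Notation index := {ffun 'I_m -> 'I_(2 * q).+1}.
Implicit Types (k l : index).

Let Y w := smoothed_count q h (M w).
Let i0 : 'I_m := Ordinal (ltnW m_gt1).
Let i1 : 'I_m := Ordinal m_gt1.
Let i01 : i0 != i1. Proof. by []. Qed.
Let N k : R := dot (theta h k) (theta h k).
Let a j k : R := phi P (column M j) (theta h k).
Let t j k l : R :=
  Ex P (fun w => cos (dot (theta h k) (column M j w)) *
                 cos (dot (theta h l) (column M j w))).
Let G : R := main_term (@weight R m q) N a tau.

Let bm_cos_dot j k : bounded_measurable (fun w => cos (dot (theta h k) (column M j w))).
Proof. exact/bm_cos/measurable_dotX. Qed.

Let measurable_cos_dot k : measurable_fun [set: borelV R m] (fun x => cos (dot (theta h k) x)).
Proof.
apply: measurableT_comp; last exact: measurable_dot.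
by apply: continuous_measurable_fun; exact: continuous_cos.
Qed.

Let measurable_column (j : 'I_n) : measurable_fun [set: T] (column M j).
Proof. by have [] := unifM j. Qed.

Lemma bm_smoothed_count : bounded_measurable Y.
Proof.
rewrite (_ : Y = fun w => \sum_(k : index) weight k *
  \prod_j cos (dot (theta h k) (column M j w))); last first.
  by apply/funext => w; exact: smoothed_countE.
by apply: bm_sum => k; apply: bmM; [exact: bm_cst|exact: bm_prod].
Qed.

Lemma Ex_smoothed_count : Ex P Y = \sum_(k : index) weight k * \prod_j a j k.
Proof.
rewrite (_ : Y = fun w => \sum_(k : index) weight k *
  \prod_j cos (dot (theta h k) (column M j w))); last first.
  by apply/funext => w; exact: smoothed_countE.
rewrite Ex_sum => [|k]; last by apply: bmM; [exact: bm_cst|exact: bm_prod].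
apply: eq_bigr => k _; rewrite ExZ; last exact: bm_prod.
congr (_ * _).
apply: (@Ex_prod_indep _ _ _ P _ _ _ (column M) (fun _ x => cos (dot (theta h k) x))) => //.
by move=> j w; exact: cos_max.
Qed.

Lemma Ex_smoothed_count_sqr :
  Ex P (fun w => Y w ^+ 2) = \sum_(k : index) \sum_(l : index)
    weight k * weight l * \prod_j t j k l.
Proof.
have bkl j k l : bounded_measurable (fun w =>
    cos (dot (theta h k) (column M j w)) * cos (dot (theta h l) (column M j w))).
  exact: bmM.
have -> : (fun w => Y w ^+ 2) = (fun w => \sum_(k : index) \sum_(l : index) weight k * weight l *
    \prod_j (cos (dot (theta h k) (column M j w)) * cos (dot (theta h l) (column M j w)))).
  apply/funext => w; rewrite /Y smoothed_countE expr2 mulr_suml.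
  apply: eq_bigr => k _; rewrite mulr_sumr; apply: eq_bigr => l _.
  by rewrite big_split /= mulrACA.
have bterm k l : bounded_measurable (fun w => weight k * weight l *
    \prod_j (cos (dot (theta h k) (column M j w)) * cos (dot (theta h l) (column M j w)))).
  by apply: bmM; [exact: bm_cst|exact: bm_prod].
rewrite Ex_sum => [|k]; last by apply: bm_sum.
apply: eq_bigr => k _; rewrite Ex_sum //; apply: eq_bigr => l _.
rewrite ExZ; last exact: bm_prod.
congr (_ * _); apply: (@Ex_prod_indep _ _ _ P _ _ _ (column M)
  (fun _ x => cos (dot (theta h k) x) * cos (dot (theta h l) x))) => // [j|j w].
  exact: measurable_funM.
by rewrite normrM mulr_ile1 ?cos_max.
Qed.

Lemma Ex_deviation :
  Ex P (fun w => (Y w - G) ^+ 2) <=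
  (expR (gap m n tau) - 1) * G ^+ 2
  + tail2 m n (@weight R m q) N tau + 2 * G * tail1 m n (@weight R m q) N tau.
Proof.
have bY := bm_smoothed_count.
have -> : (fun w => (Y w - G) ^+ 2) =
    (fun w => Y w ^+ 2 + ((- (2 * G)) * Y w + G ^+ 2)).
  by apply/funext => w; ring.
have bGY : bounded_measurable (fun w => - (2 * G) * Y w).
  by apply: bmM => //; exact: bm_cst.
rewrite ExD; [|exact: bmX|by apply: bmD => //; exact: bm_cst].
rewrite ExD //; last exact: bm_cst.
rewrite ExZ // Ex_cst Ex_smoothed_count Ex_smoothed_count_sqr.
(* The first moment factor is the second moment factor at frequencies [theta], 0. *)
have phiE j k : a j k = Ex P (fun w => cos (dot (theta h k) (column M j w)) *
    cos (dot (0 : 'cV[R]_m) (column M j w))).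
  by congr (Ex P _); apply/funext => w; rewrite dot0l cos0 mulr1.
have mR : 0 < m%:R :> R by rewrite ltr0n ltnW.
rewrite mulNr [leLHS]addrA.
apply: (@deviation_le R _ m n (@weight R m q) N a t tau m_gt1) => //.
- exact: weight_ge0.
- exact: sum_weight.
- by move=> k; exact: dot_ge0.
- by move=> j k; rewrite phiE; have := Ex_cos_cos_ge (unifM j) i0 (theta h k) 0;
  rewrite dot0l addr0.
- by move=> j k; rewrite phiE; have := Ex_cos_cos_le (unifM j) i0 (theta h k) 0;
  rewrite dot0l addr0.
- by move=> j k; rewrite phiE => k1; apply: (Ex_cos_cos_far (unifM j) i01) => //;
  rewrite dot0l addr0.
- by move=> j k l; exact: (Ex_cos_cos_ge (unifM j) i0).
- by move=> j k l; exact: (Ex_cos_cos_le (unifM j) i0).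
- by move=> j k l; exact: (Ex_cos_cos_far (unifM j) i01).
Qed.

Let weight0 k : 0 <= @weight R m q k := weight_ge0 k.

Lemma main_term_heat :
  heat m q h (n%:R / m%:R)
  - expR (- (3 * (n%:R / m%:R) * tau / 4)) * heat m q h (n%:R / m%:R / 4) <= G.
Proof.
apply: main_term_ge => //; first by move=> k; exact: dot_ge0.
move=> j k; have := Ex_cos_cos_ge (unifM j) i0 (theta h k) 0; rewrite dot0l addr0.
rewrite (_ : Ex P _ = a j k) //.
by congr (Ex P _); apply/funext => w; rewrite dot0l cos0 mulr1.
Qed.

(** Chebyshev around the constant [G]: if all signings are bad, the smoothed
    count is at most [G / 2]. *)
Lemma disc_le_probability (e : R) : 0 <= e -> (0 < n)%N -> h = n%:R^-1 -> 0 < G ->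
  expR (- (q%:R * (h * e) ^+ 2 / 2)) <= G / 2 ->
  1 - 4 / G ^+ 2 * ((expR (gap m n tau) - 1) * G ^+ 2
  + tail2 m n (@weight R m q) N tau + 2 * G * tail1 m n (@weight R m q) N tau)
  <= fine (P [set w | disc (M w) <= e]).
Proof.
move=> e0 n0 hE G0 kernel.
have mE := measurable_disc_le measurable_column e0.
rewrite -Ex_indicator //.
have bI := bm_indicator mE.
have bD : bounded_measurable (fun w => (Y w - G) ^+ 2).
  apply: bmX; apply: bmD; first exact: bm_smoothed_count.
  exact: bm_cst.
have bD' : bounded_measurable (fun w => 4 / G ^+ 2 * (Y w - G) ^+ 2).
  by apply: bmM => //; exact: bm_cst.
have c0 : 0 <= 4 / G ^+ 2 by rewrite divr_ge0 ?sqr_ge0.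
have : Ex P (fun=> 1) <= Ex P (fun w => \1_[set w | disc (M w) <= e] w
    + 4 / G ^+ 2 * (Y w - G) ^+ 2).
  apply: Ex_le => [||w]; [exact: bm_cst|exact: bmD|].
  rewrite indicE; have [_|/negP nE] := boolP (w \in _).
    by rewrite lerDl mulr_ge0 ?sqr_ge0.
  have Ysmall : Y w <= G / 2.
    apply: le_trans kernel; apply: smoothed_count_small => //.
    - by rewrite hE invr_ge0.
    - move=> s i; rewrite normrM hE ger0_norm ?invr_ge0 // mulrC ler_pdivrMr ?ltr0n // mul1r.
      by apply: signed_sum_le => j; have [_ + _] := unifM j; exact.
    - move=> s; apply: contrapT => /forallNP H; apply: nE; apply/mem_set => /=.
      apply/(disc_leP _ e0); exists s => i; rewrite leNgt; apply/negP; exact: H.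
  rewrite add0r mulrAC ler_pdivlMr ?exprn_gt0 // mul1r.
  have : (G / 2) ^+ 2 <= (G - Y w) ^+ 2.
    by rewrite lerXn2r ?nnegrE; lra.
  lra.
rewrite Ex_cst ExD // ExZ // => H.
have := ler_wpM2l c0 Ex_deviation; lra.
Qed.

End Frequencies.
End DiscrepancyProbability.

(** * Normalising the columns on every outcome *)

Section Normalisation.
Context {d : measure_display} {T : measurableType d} {R : realType} {m n : nat}.
Variables (P : probability T R) (M : T -> 'M[R]_(m, n)).
Hypothesis HM : indep_uniform_unit_columns P M.
Variable i0 : 'I_m.

Lemma unit_sphereE (u : borelV R m) : unit_sphere u <-> dot u u = 1.
Proof.
have s0 : 0 <= \sum_i (u : 'cV[R]_m) i ord0 ^+ 2 by apply: sumr_ge0 => i _; exact: sqr_ge0.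
have -> : dot u u = \sum_i (u : 'cV[R]_m) i ord0 ^+ 2 by apply: eq_bigr => i _; rewrite expr2.
rewrite /unit_sphere /l2norm /=; split => [H|->]; last by rewrite sqrtr1.
by rewrite -[LHS]sqr_sqrtr // H expr1n.
Qed.

Lemma measurable_unit_sphere : measurable (unit_sphere : set (borelV R m)).
Proof.
have -> : unit_sphere = [set: borelV R m] `&` (fun u : borelV R m => dot u u) @^-1` [set 1].
  by rewrite setTI; apply/seteqP; split => u /unit_sphereE.
have mf : measurable_fun [set: borelV R m] (fun u : borelV R m => dot u u).
  apply: measurable_sum => i; apply: measurable_funM;
  by under eq_fun do rewrite -dot_unit_vec; exact: measurable_dot.
by apply: mf => //; exact: measurable_set1.
Qed.

Definition all_unit : set T :=
  \bigcap_(j in [set` [set: 'I_n]%SET]) (column M j @^-1` unit_sphere).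

Lemma measurable_all_unit : measurable all_unit.
Proof.
have [mM _ _] := HM; apply: fin_bigcap_measurable => // j _.
rewrite -[X in measurable X]setTI; apply: mM => //; exact: measurable_unit_sphere.
Qed.

Lemma all_unit1 : P all_unit = 1%E.
Proof.
have [_ uM indM] := HM.
rewrite indM; last by move=> j _; exact: measurable_unit_sphere.
by rewrite big1 // => j _; have [] := uM j.
Qed.

Lemma P_all_unit (A : set T) : measurable A -> P (A `&` all_unit) = P A.
Proof.
move=> mA; have mD := measurable_all_unit.
have z : P (A `\` all_unit) = 0%E.
  apply/eqP; rewrite eq_le measure_ge0 andbT.
  apply: (@le_trans _ _ (P (~` all_unit))).
    apply: le_measure; rewrite ?inE; [exact: measurableD|exact: measurableC|].
    by rewrite setDE; exact: subIsetr.
  by rewrite probability_setC // all_unit1 subee.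
have := measureDI P mA mD; rewrite -[X in _ = X]/(P (A `\` all_unit) + P (A `&` all_unit))%E.
by rewrite z add0e.
Qed.

Lemma P_eq_all_unit (A B : set T) : measurable A -> measurable B ->
  A `&` all_unit = B `&` all_unit -> P A = P B.
Proof. by move=> mA mB AB; rewrite -P_all_unit // AB P_all_unit. Qed.

(** The columns have length one only almost surely; on the exceptional event
    they are replaced by a basis vector, so that the functions of the columns
    whose expectations are taken are bounded. *)
Definition normalised (w : T) : 'M[R]_(m, n) :=
  if w \in all_unit then M w else \matrix_(i, j) (i == i0)%:R.

Lemma normalisedE w : all_unit w -> normalised w = M w.
Proof. by move=> Dw; rewrite /normalised mem_set. Qed.

Lemma preimage_normalised j (A : set (borelV R m)) :
  (column normalised j @^-1` A) `&` all_unit = (column M j @^-1` A) `&` all_unit.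
Proof.
by apply/seteqP; split => w [Aw Dw]; split => //; move: Aw; rewrite /= /column normalisedE.
Qed.

Lemma measurable_normalised j : measurable_fun [set: T] (column normalised j).
Proof.
have [mM _ _] := HM; move=> _ A mA; rewrite setTI.
have mD := measurable_all_unit.
pose c : borelV R m := unit_vec i0.
have -> : column normalised j @^-1` A =
    (column M j @^-1` A) `&` all_unit `|` (~` all_unit) `&` [set _ | A c].
  rewrite -preimage_normalised; apply/seteqP; split => w /=.
    move=> Aw; have [Dw|nDw] := pselect (all_unit w); [by left|right; split => //].
    rewrite (_ : c = column normalised j w) //.
    rewrite /column /normalised memNset //; apply/matrixP => i k.
    by rewrite /c !mxE (ord1 k) eqxx andbT.
  move=> [[]//|[nDw Ac]]; rewrite (_ : column normalised j w = c) //.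
  rewrite /column /normalised memNset //; apply/matrixP => i k.
  by rewrite /c !mxE (ord1 k) eqxx andbT.
apply: measurableU; apply: measurableI => //; last first.
- have [Ac|nAc] := pselect (A c).
    by rewrite (_ : [set _ | A c] = setT) //; apply/seteqP; split.
  by rewrite (_ : [set _ | A c] = set0) //; apply/seteqP; split.
- exact: measurableC.
- by rewrite -[X in measurable X]setTI; exact: mM.
Qed.

Lemma normalised_law j (A : set (borelV R m)) : measurable A ->
  P (column normalised j @^-1` A) = P (column M j @^-1` A).
Proof.
move=> mA; have [mM _ _] := HM; apply: P_eq_all_unit.
- by rewrite -[X in measurable X]setTI; exact: measurable_normalised.
- by rewrite -[X in measurable X]setTI; exact: mM.
- exact: preimage_normalised.
Qed.

Lemma normalised_isotropic j : isotropic_unit_vector P (column normalised j).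
Proof.
have [mM uM _] := HM; split.
- exact: measurable_normalised.
- move=> w; have [Dw|nDw] := pselect (all_unit w).
    by rewrite /column normalisedE //; apply/unit_sphereE; apply: Dw; rewrite /= inE.
  rewrite /column /normalised memNset // /dot (bigD1 i0) //= big1 => [|i /negbTE ii0].
    by rewrite !mxE eqxx mulr1 addr0.
  by rewrite !mxE ii0 mul0r.
- move=> u v B uv mB; have [_ inv] := uM j.
  have [Q oQ QE] := reflection_exchange uv.
  have mB' (x : 'cV[R]_m) : measurable [set y : borelV R m | B (dot x y)].
    by rewrite -[X in measurable X]setTI; apply: measurable_dot.
  transitivity (P (column M j @^-1` [set y | B (dot u y)])).
    exact: (normalised_law j (mB' u)).
  transitivity (P (column M j @^-1` [set y | B (dot v y)])); last first.
    by rewrite -(normalised_law j (mB' v)).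
  rewrite -[LHS](inv Q _ oQ (mB' u)); congr (P _).
  by apply/seteqP; split => w /=; rewrite QE.
Qed.

Lemma normalised_indep : mutually_independent P (column normalised).
Proof.
have [mM _ indM] := HM => J A mA.
have mpre (N : T -> 'M[R]_(m, n)) : (forall j, measurable_fun [set: T] (column N j)) ->
    measurable (\bigcap_(j in [set` J]) (column N j @^-1` A j)).
  move=> mN; apply: fin_bigcap_measurable => // j jJ.
  by rewrite -[X in measurable X]setTI; apply: mN => //; exact: mA.
rewrite (eq_bigr (fun j => P (column M j @^-1` A j))) => [|j jJ]; last first.
  exact: normalised_law (mA j jJ).
rewrite -indM //; apply: P_eq_all_unit.
- by apply: mpre; exact: measurable_normalised.
- exact: mpre.
- apply/seteqP; split => w [H Dw]; split => // j jJ; have := H j jJ;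
  by rewrite /= /column normalisedE.
Qed.

Lemma normalised_disc (e : R) : 0 <= e ->
  P [set w | disc (M w) <= e] = P [set w | disc (normalised w) <= e].
Proof.
move=> e0; have [mM _ _] := HM; apply: P_eq_all_unit.
- exact: measurable_disc_le.
- by apply: measurable_disc_le => //; exact: measurable_normalised.
- by apply/seteqP; split => w [/= + Dw]; rewrite normalisedE.
Qed.

End Normalisation.
(** * Choice of parameters *)

Section Constants.
Context {R : realType}.

Lemma expR_half_le2 : expR (1 / 2) <= 2 :> R.
Proof.
have h : 1 - 1 / 2 <= expR (- (1 / 2)) :> R by exact: expR_ge1Dx.
have e := expRxMexpNx_1 (1 / 2 : R); have p := expR_gt0 (1 / 2 : R).
have := ler_wpM2l (ltW p) h; lra.
Qed.

Lemma four_le_expR2 : 4 <= expR 2 :> R.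
Proof.
have h : 1 + 1 <= expR 1 :> R by exact: expR_ge1Dx.
rewrite -[2]mulr1 expRM_natl (_ : 4 = 2 ^+ 2); last by ring.
by rewrite lerXn2r ?nnegrE ?expR_ge0 //; lra.
Qed.

Lemma le_of_expR_le (x b : R) : expR b <= expR x -> b <= x.
Proof. by rewrite ler_expR. Qed.

Lemma chebyshev_bound (G H g eg t1 t2 r : R) : 0 < H -> H / 2 <= G -> 0 <= r ->
  eg <= 2 * g -> t1 <= 2 * (H * r) -> t2 <= 2 * (H ^+ 2 * r) ->
  4 / G ^+ 2 * (eg * G ^+ 2 + t2 + 2 * G * t1) <= 8 * g + 64 * r.
Proof.
move=> H0 HG r0 egg t1r t2r.
have G0 : 0 < G by lra.
have G2 : 0 < G ^+ 2 by rewrite exprn_gt0.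
rewrite mulrAC ler_pdivrMr //.
have e1 := ler_wpM2r (ltW G2) egg.
have e2 : H ^+ 2 * r <= (2 * G) ^+ 2 * r.
  by rewrite ler_wpM2r // lerXn2r ?nnegrE //; lra.
have e3 := ler_wpM2l (ltW G0) t1r.
have e4 : G * (H * r) <= G * (2 * G * r).
  by rewrite ler_wpM2l ?(ltW G0) // ler_wpM2r //; lra.
rewrite exprMn in e2; lra.
Qed.

Variables (m n : nat).
Hypothesis m_gt1 : (1 < m)%N.
Hypothesis n_large : (64 * 64 * m%:R) ^+ 3 <= n%:R :> R.

Local Notation l := (ln (n%:R : R)).

Lemma m_ge2 : 2 <= m%:R :> R. Proof. by rewrite ler_nat. Qed.

Lemma n_gt0 : 0 < n%:R :> R.
Proof.
have m2 := m_ge2; apply: lt_le_trans n_large.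
by rewrite exprn_gt0 // mulr_gt0 //; lra.
Qed.

Lemma n_expR : n%:R = expR l :> R.
Proof. by rewrite lnK // posrE n_gt0. Qed.

(** The cube root of [n], the unit in which [m] and [ln n] are measured: both
    are at most a constant times [croot], the constant for [m] being small. *)
Definition croot : R := expR (l / 3).

Lemma crootE : croot ^+ 3 = n%:R.
Proof. by rewrite n_expR /croot -expRM_natl; congr expR; lra. Qed.

Lemma m_le_croot : 64 * 64 * m%:R <= croot.
Proof.
have m2 := m_ge2.
rewrite -(@ler_pXn2r _ 3) // ?nnegrE ?expR_ge0 ?crootE //; lra.
Qed.

Lemma l_le_croot : l <= 3 * croot.
Proof. have := expR_ge1Dx (l / 3); rewrite -/croot; lra. Qed.

Lemma croot_ge : 128 * 64 <= croot.
Proof. have := m_le_croot; have := m_ge2; lra. Qed.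

Lemma croot_le_n : croot <= n%:R.
Proof.
have c := croot_ge; rewrite -crootE -[leLHS]expr1; apply: ler_weXn2l => //; lra.
Qed.

Lemma l_ge4 : 4 <= l.
Proof.
apply: le_of_expR_le; rewrite -n_expR.
rewrite (_ : 4 = 8%:R * (1 / 2)); last by lra.
rewrite expRM_natl; apply: le_trans (_ : 2 ^+ 8 <= _).
  by rewrite lerXn2r ?nnegrE ?expR_ge0 // expR_half_le2.
by rewrite -natrX; have := croot_le_n; have := croot_ge; lra.
Qed.

(** With this choice [(n / m) * cutoff / 8 = 4 m + ln n]: the Gaussian factor
    outside the cutoff absorbs the doubling factor [4 ^ (2 m)] and still gains
    [1 / n]. *)
Definition cutoff : R := 8 * m%:R * (4 * m%:R + l) / n%:R.

Lemma sum_le_croot : 0 <= 4 * m%:R + l <= 4 * croot.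
Proof.
have := m_le_croot; have := l_le_croot; have := l_ge4; have := m_ge2; lra.
Qed.

Lemma cutoff_bounds : 0 <= cutoff <= 1 / 2.
Proof.
have n0 := n_gt0; have /andP[s0 s1] := sum_le_croot; have m2 := m_ge2.
have c := croot_ge.
rewrite /cutoff divr_ge0 ?mulr_ge0 //= ler_pdivrMr // -[X in _ <= _ * X]crootE.
have h1 : 8 * m%:R * (4 * m%:R + l) <= croot / (8 * 64) * (4 * croot).
  by apply: ler_pM => //; have := m_le_croot; lra.
have h2 : 1 * croot ^+ 2 <= croot * croot ^+ 2 by rewrite ler_wpM2r ?sqr_ge0 //; lra.
rewrite (_ : croot ^+ 3 = croot * croot ^+ 2); last by ring.
rewrite (_ : croot / (8 * 64) * (4 * croot) = croot ^+ 2 / 128) in h1; last by field.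
have := sqr_ge0 croot; lra.
Qed.

Lemma gap_cutoff : gap m n cutoff = 128 * ((4 * m%:R + l) ^+ 2 / n%:R).
Proof.
have n0 := n_gt0; have m2 := m_ge2; rewrite /gap /cutoff; field.
by rewrite !gt_eqF //; lra.
Qed.

Lemma gap_le : 0 <= gap m n cutoff <= 1 / 2.
Proof.
have n0 := n_gt0; have /andP[s0 s1] := sum_le_croot; have c := croot_ge.
rewrite gap_cutoff mulr_ge0 ?divr_ge0 ?sqr_ge0 ?ler0n //=.
rewrite mulrA ler_pdivrMr // -[X in _ <= _ * X]crootE.
have h1 : (4 * m%:R + l) ^+ 2 <= (4 * croot) ^+ 2.
  by rewrite lerXn2r ?nnegrE //; lra.
have h2 : 128 * 64 * croot ^+ 2 <= croot * croot ^+ 2 by rewrite ler_wpM2r ?sqr_ge0.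
rewrite (_ : croot ^+ 3 = croot * croot ^+ 2); last by ring.
rewrite exprMn in h1; have := sqr_ge0 croot; lra.
Qed.

Variable S : R.
Hypothesis S_ge0 : 0 <= S.
Hypothesis S_sqr : S ^+ 2 * m%:R ^+ 3 = n%:R.

(** The large frequencies are negligible even against the smallest possible
    value of the main term. *)
Lemma far_exponent : 10 * m%:R * (l + S) + l <= n%:R / m%:R / 8.
Proof.
have n0 := n_gt0; have m2 := m_ge2; have c := croot_ge.
have m0 : 0 < m%:R :> R by lra.
have S0 := S_ge0; have l4 := l_ge4.
have A1 : 176 * m%:R ^+ 2 * l <= n%:R.
  apply: (@le_trans _ _ (176 * m%:R ^+ 2 * (3 * croot))).
    by rewrite ler_wpM2l ?mulr_ge0 ?sqr_ge0 // l_le_croot.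
  have h : (64 * 64 * m%:R) ^+ 2 <= croot ^+ 2.
    by rewrite lerXn2r ?nnegrE ?m_le_croot //; lra.
  have : 0 <= (croot ^+ 2 - (64 * 64 * m%:R) ^+ 2) * croot by apply: mulr_ge0; lra.
  have : 0 <= m%:R ^+ 2 * croot by apply: mulr_ge0; [exact: sqr_ge0|lra].
  rewrite -crootE; lra.
have A2 : 160 * m%:R ^+ 2 * S <= n%:R.
  have Sm : 160 <= S * m%:R.
    rewrite -(@ler_pXn2r _ 2) // ?nnegrE //; last by rewrite mulr_ge0 // ltW.
    rewrite -(ler_pM2r m0) (_ : (S * m%:R) ^+ 2 * m%:R = n%:R); last by rewrite -S_sqr; ring.
    apply: le_trans n_large.
    have : 4 * m%:R <= m%:R ^+ 2 * m%:R :> R.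
      apply: ler_wpM2r; first exact: ltW.
      by rewrite (_ : 4 = 2 ^+ 2); [rewrite lerXn2r ?nnegrE //; lra|ring].
    by rewrite exprMn (_ : m%:R ^+ 3 = m%:R ^+ 2 * m%:R); [lra|ring].
  have : 0 <= (S * m%:R - 160) * (S * m%:R ^+ 2).
    by apply: mulr_ge0; [lra|rewrite mulr_ge0 ?sqr_ge0].
  rewrite -S_sqr; lra.
have m1l : l <= m%:R * l by rewrite ler_peMl //; lra.
rewrite -(ler_pM2r m0).
rewrite (_ : n%:R / m%:R / 8 * m%:R = n%:R / 8); last by field; rewrite gt_eqF.
have m1ml : m%:R * l <= m%:R ^+ 2 * l by rewrite ler_wpM2r //; [lra|rewrite expr2 ler_peMr //; lra].
have e1 : l * m%:R <= m%:R ^+ 2 * l by rewrite mulrC.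
lra.
Qed.

Local Notation Lk := (l + S).
(** With [kappa = exp Lk = n * exp S], the degree is of order [kappa ^ 4]: a
    coordinate of size [exp (- S)] makes the bump at most
    [exp (- kappa ^ 2 / 2)], while the main term is at least
    [kappa ^ (- 5 m) / 2]. *)
Definition half_degree : nat := (Num.truncn (expR (4 * Lk))).+1.

Lemma half_degree_gt : expR (4 * Lk) <= half_degree%:R.
Proof. by apply/ltW/truncnS_gt. Qed.

Lemma expR_Lk_ge : n%:R <= expR Lk.
Proof. by rewrite [leLHS]n_expR ler_expR lerDl. Qed.

Lemma degree_le : (2 * half_degree).+1%:R <= expR (5 * Lk).
Proof.
have t0 : (Num.truncn (expR (4 * Lk)))%:R <= expR (4 * Lk) :> R.
  by have /andP[] := truncn_itv (expR_ge0 (4 * Lk)).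
rewrite -natr1 natrM /half_degree -natr1.
rewrite (_ : 5 * Lk = 4 * Lk + Lk); last by ring.
rewrite expRD.
have k5 : 5 <= expR Lk by have := expR_Lk_ge; have := croot_le_n; have := croot_ge; lra.
have k1 : 1 <= expR (4 * Lk) by rewrite -[leLHS]expR0 ler_expR; have := l_ge4; have := S_ge0; lra.
have : expR (4 * Lk) * 5 <= expR (4 * Lk) * expR Lk by rewrite ler_wpM2l ?expR_ge0.
lra.
Qed.

Lemma heat_lower h B : expR (- (5 * m%:R * Lk)) <= heat m half_degree h B.
Proof.
apply: le_trans (heat_ge m half_degree h B).
rewrite expRN lef_pV2 ?posrE ?exprn_gt0 ?expR_gt0 //.
rewrite (_ : 5 * m%:R * Lk = m%:R * (5 * Lk)); last by ring.
by rewrite expRM_natl lerXn2r ?nnegrE ?expR_ge0 // degree_le.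
Qed.

Lemma kernel_exponent :
  expR (- (half_degree%:R * (n%:R^-1 * expR (- S)) ^+ 2 / 2)) <=
  expR (- (5 * m%:R * Lk)) / 4.
Proof.
have S0 := S_ge0; have l4 := l_ge4; have c := croot_ge; have m2 := m_ge2.
have k1 := expR_ge1Dx Lk.
have k2 : 20 * m%:R <= expR Lk.
  by have := expR_Lk_ge; have := croot_le_n; have := m_le_croot; lra.
have he : n%:R^-1 * expR (- S) = expR (- Lk) by rewrite [X in X^-1]n_expR -expRN -expRD opprD.
have q2 : expR (2 * Lk) <= half_degree%:R * (n%:R^-1 * expR (- S)) ^+ 2.
  rewrite he -[_ ^+ 2]expRM_natl.
  rewrite (_ : 2 * Lk = 4 * Lk + 2 * - Lk); last by ring.
  by rewrite expRD ler_wpM2r ?expR_ge0 // half_degree_gt.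
have k3 : 20 * m%:R * (1 + Lk) <= expR (2 * Lk).
  by rewrite expRM_natl expr2; apply: ler_pM => //; lra.
apply: (@le_trans _ _ (expR (- (5 * m%:R * Lk) - 2))).
  have mL : 0 <= m%:R * Lk by apply: mulr_ge0; lra.
  by rewrite ler_expR; lra.
rewrite expRD ler_wpM2l ?expR_ge0 // expRN lef_pV2 ?posrE ?expR_gt0 //.
exact: four_le_expR2.
Qed.

(** Here [H] and [Hq] stand for the Gaussian sums at [n / m] and at a quarter
    of it; the hypotheses are what [heat_lower] and [heat_doubling] give. *)
Section Tails.
Variables (H Hq : R).
Hypothesis H_ge : expR (- (5 * m%:R * Lk)) <= H.
Hypothesis Hq_ge0 : 0 <= Hq.
Hypothesis Hq_le : Hq <= 4 ^+ m * H.
Local Notation A := (n%:R / m%:R : R).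

Let H_gt0 : 0 < H. Proof. exact: lt_le_trans (expR_gt0 _) H_ge. Qed.

Let A_cutoff : A * cutoff = 8 * (4 * m%:R + l).
Proof.
have n0 := n_gt0; have m2 := m_ge2; rewrite /cutoff; field.
by rewrite !gt_eqF //; lra.
Qed.

Let Hq_exp : Hq <= expR (2 * m%:R) * H.
Proof.
apply: le_trans Hq_le _; rewrite ler_wpM2r ?(ltW H_gt0) //.
rewrite mulrC expRM_natl lerXn2r ?nnegrE ?expR_ge0 //; exact: four_le_expR2.
Qed.

Let inv_n : n%:R^-1 = expR (- l).
Proof. by rewrite [X in X^-1]n_expR expRN. Qed.

Lemma tail1_le :
  expR (- (A * cutoff / 8)) * Hq + expR (- (A / 8)) <= 2 * (H * n%:R^-1).
Proof.
have m2 := m_ge2; have S0 := S_ge0; have l4 := l_ge4.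
rewrite [leRHS]mulr_natl mulr2n; apply: lerD.
  apply: le_trans (ler_wpM2l (expR_ge0 _) Hq_exp) _.
  rewrite mulrA -expRD [H * _]mulrC ler_wpM2r ?(ltW H_gt0) // inv_n ler_expR A_cutoff; lra.
apply: (@le_trans _ _ (expR (- (5 * m%:R * Lk)) * expR (- l))).
  have mL : 0 <= m%:R * Lk by apply: mulr_ge0; lra.
  by rewrite -expRD ler_expR; have := far_exponent; lra.
by rewrite inv_n ler_wpM2r ?expR_ge0.
Qed.

Lemma tail2_le :
  expR (- (A * cutoff / 8)) * Hq ^+ 2 + expR (- (A / 8)) <= 2 * (H ^+ 2 * n%:R^-1).
Proof.
have m2 := m_ge2; have S0 := S_ge0; have l4 := l_ge4.
rewrite [leRHS]mulr_natl mulr2n; apply: lerD.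
  have sq : Hq ^+ 2 <= (expR (2 * m%:R) * H) ^+ 2.
    by rewrite lerXn2r ?nnegrE // mulr_ge0 ?expR_ge0 ?ltW.
  apply: le_trans (ler_wpM2l (expR_ge0 _) sq) _.
  rewrite exprMn -[expR (2 * m%:R) ^+ 2]expRM_natl [leLHS]mulrA -expRD [H ^+ 2 * _]mulrC.
  by rewrite ler_wpM2r ?sqr_ge0 // inv_n ler_expR A_cutoff; lra.
apply: (@le_trans _ _ (expR (- (5 * m%:R * Lk)) ^+ 2 * expR (- l))).
  rewrite -expRM_natl -expRD ler_expR; have := far_exponent; lra.
rewrite inv_n ler_wpM2r ?expR_ge0 // lerXn2r ?nnegrE ?expR_ge0 ?(ltW H_gt0) //.
Qed.

Lemma near_fraction : expR (- (3 * A * cutoff / 4)) * Hq <= H / 2.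
Proof.
have m2 := m_ge2; have S0 := S_ge0; have l4 := l_ge4.
apply: le_trans (ler_wpM2l (expR_ge0 _) Hq_exp) _.
rewrite mulrA -expRD mulrC ler_wpM2l ?(ltW H_gt0) //.
apply: (@le_trans _ _ (expR (- 1))).
  by rewrite ler_expR -[3 * A * _]mulrA A_cutoff; lra.
rewrite expRN lef_pV2 ?posrE ?expR_gt0 //.
have : 1 + 1 <= expR 1 :> R by exact: expR_ge1Dx.
lra.
Qed.

End Tails.
End Constants.

Section Conclusion.
Context {R : realType} {m n : nat}.
Hypothesis m_gt1 : (1 < m)%N.
Hypothesis n_large : (64 * 64 * m%:R) ^+ 3 <= n%:R :> R.
Local Notation l := (ln (n%:R : R)).

Lemma disc_small_probability {d : measure_display} {T : measurableType d}
    (P : probability T R) (M : T -> 'M[R]_(m, n)) (S : R) :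
  (forall j, isotropic_unit_vector P (column M j)) ->
  mutually_independent P (column M) ->
  0 <= S -> S ^+ 2 * m%:R ^+ 3 = n%:R ->
  1 - 2 ^+ 11 * ((4 * m%:R + l) ^+ 2 / n%:R)
  <= fine (P [set w | disc (M w) <= expR (- S)]).
Proof.
move=> unifM indepM S0 SS.
have n0 := n_gt0 m_gt1 n_large.
have m2 := m_ge2 (R := R) m_gt1.
have l4 := l_ge4 m_gt1 n_large.
have tb := cutoff_bounds m_gt1 n_large.
have [g0 g1] := andP (gap_le m_gt1 n_large).
pose h : R := n%:R^-1; pose q := half_degree n S.
pose H := heat m q h (n%:R / m%:R).
pose Hq := heat m q h (n%:R / m%:R / 4).
have H_ge : expR (- (5 * m%:R * (l + S))) <= H by exact: heat_lower.
have H0 : 0 < H by exact: lt_le_trans (expR_gt0 _) H_ge.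
have Hq_ge0 : 0 <= Hq.
  by apply: sumr_ge0 => k _; rewrite mulr_ge0 ?expR_ge0 ?weight_ge0.
have Hq_le : Hq <= 4 ^+ m * H by apply: heat_doubling; rewrite divr_ge0.
set G := main_term (@weight R m q) (fun k => dot (theta h k) (theta h k))
  (fun j k => phi P (column M j) (theta h k)) (cutoff m n).
have HG : H / 2 <= G.
  have mt : H - expR (- (3 * (n%:R / m%:R) * cutoff m n / 4)) * Hq <= G.
    exact: main_term_heat.
  have := near_fraction m_gt1 n_large S0 H_ge Hq_le; lra.
have n0' : (0 < n)%N by rewrite -(ltr0n R).
apply: le_trans (disc_le_probability (q := q) (h := h) (tau := cutoff m n)
  unifM indepM m_gt1 tb (expR_ge0 _) n0' erefl _ _); last 2 first.
- rewrite -/G; lra.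
- apply: le_trans (kernel_exponent m_gt1 n_large S0) _; rewrite -/G; lra.
rewrite -/G lerD2l lerNl opprK.
have r0 : 0 <= n%:R^-1 :> R by rewrite invr_ge0 ltW.
apply: le_trans (chebyshev_bound H0 HG r0 (expR_sub1_le _)
   (tail1_le m_gt1 n_large S0 SS H_ge Hq_le)
   (tail2_le m_gt1 n_large S0 SS H_ge Hq_ge0 Hq_le)) _; first by rewrite g0.
rewrite gap_cutoff //.
(* [8 * gap] contributes [8 * 128] and the tails 64 to the constant. *)
have : 1 * n%:R^-1 <= (4 * m%:R + l) ^+ 2 * n%:R^-1.
  by rewrite ler_wpM2r // -[leLHS](expr1n _ 2) lerXn2r ?nnegrE //; lra.
lra.
Qed.

Lemma error_le :
  2 ^+ 11 * ((4 * m%:R + l) ^+ 2 / n%:R) <= 2 ^+ 17 * Num.sqrt m%:R * Num.sqrt (l / n%:R).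
Proof.
have n0 := n_gt0 m_gt1 n_large.
have m2 := m_ge2 (R := R) m_gt1.
have l4 := l_ge4 m_gt1 n_large.
have m0 : 0 < m%:R :> R by lra.
have c := croot_ge m_gt1 n_large.
have ln0 : 0 <= l / n%:R by rewrite divr_ge0 ?ltW //; lra.
rewrite -mulrA -sqrtrM ?ler0n //.
set Z := Num.sqrt _.
have ZZ : Z ^+ 2 = m%:R * (l / n%:R) by apply: sqr_sqrtr; apply: mulr_ge0.
have Z0 : 0 <= Z by exact: sqrtr_ge0.
have bound (x : R) (b : R) : 0 <= x -> 0 <= b ->
    x ^+ 2 <= b ^+ 2 * (m%:R * l * n%:R) -> x / n%:R <= b * Z.
  move=> x0 b0 H.
  rewrite -(@ler_pXn2r _ 2) // ?nnegrE ?mulr_ge0 ?invr_ge0 ?(ltW n0) //.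
  rewrite !exprMn ZZ exprVn ler_pdivrMr ?exprn_gt0 //.
  rewrite (_ : b ^+ 2 * _ * _ = b ^+ 2 * (m%:R * l * n%:R)) //.
  by field; rewrite gt_eqF.
have B1 : m%:R ^+ 2 / n%:R <= 1 * Z.
  apply: bound => //; rewrite ?sqr_ge0 // expr1n mul1r.
  have h1 : m%:R ^+ 3 <= n%:R :> R.
    apply: le_trans n_large; rewrite lerXn2r ?nnegrE //; lra.
  have h2 : n%:R * 1 <= n%:R * l by rewrite ler_wpM2l ?(ltW n0) //; lra.
  have h3 : m%:R * m%:R ^+ 3 <= m%:R * (n%:R * l) by rewrite ler_wpM2l ?(ltW m0) //; lra.
  lra.
have B2 : l ^+ 2 / n%:R <= 6 * Z.
  apply: bound => //; rewrite ?sqr_ge0 //.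
  have lc : l <= 3 * croot n by exact: l_le_croot.
  have h1 : l ^+ 3 <= (3 * croot n) ^+ 3 by rewrite lerXn2r ?nnegrE //; lra.
  rewrite exprMn (crootE m_gt1 n_large) in h1.
  have h2 : l * l ^+ 3 <= l * (3 ^+ 3 * n%:R) by rewrite ler_wpM2l //; lra.
  have h3 : 1 * (l * n%:R) <= m%:R * (l * n%:R).
    by rewrite ler_wpM2r ?mulr_ge0 //; lra.
  have h4 : 0 <= l * n%:R by rewrite mulr_ge0 //; lra.
  lra.
have r0 : 0 <= n%:R^-1 :> R by rewrite invr_ge0 ltW.
have : (4 * m%:R + l) ^+ 2 / n%:R <= (32 * m%:R ^+ 2 + 2 * l ^+ 2) / n%:R.
  rewrite ler_wpM2r //; have := sqr_ge0 (4 * m%:R - l); lra.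
rewrite mulrDl; lra.
Qed.

End Conclusion.

Theorem theorem1p11 (R : realType) :
  exists c C C' : R, [/\ 0 < c, 0 < C & 0 < C'] /\
    forall (m n : nat),
      (2 <= m)%N ->
      c * m%:R ^+ 3 * ln (m%:R : R) ^+ 2 <= n%:R ->
      forall (d : measure_display) (T : measurableType d)
        (P : probability T R) (M : T -> 'M[R]_(m, n)),
        indep_uniform_unit_columns P M ->
        ((1 - C' * Num.sqrt m%:R * Num.sqrt (ln (n%:R : R) / n%:R))%R%:E <=
         P [set w | (disc (M w) <= C * expR (- Num.sqrt (n%:R / m%:R ^+ 3)))%R])%E.
Proof.
(* The factor 4 pays for [ln m ^ 2 >= 1 / 4], which holds as [ln 2 >= 1 / 2]. *)
exists (4 * (64 * 64) ^+ 3), 1, (2 ^+ 17); split.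
  by split; rewrite ?mulr_gt0 ?exprn_gt0 ?mulr_gt0.
move=> m n m2 n_ge d T P M HM.
have m2R : 2 <= m%:R :> R by rewrite ler_nat.
have m0 : 0 < m%:R :> R by lra.
have lnm : 1 / 2 <= ln m%:R :> R.
  apply: le_of_expR_le; rewrite lnK ?posrE //.
  by apply: le_trans expR_half_le2 _.
have n_large : (64 * 64 * m%:R) ^+ 3 <= n%:R :> R.
  apply: le_trans n_ge; rewrite exprMn.
  have l2 : (1 / 2) ^+ 2 <= ln m%:R ^+ 2 :> R by rewrite lerXn2r ?nnegrE //; lra.
  have m3 : 0 <= 4 * (64 * 64) ^+ 3 * m%:R ^+ 3 :> R.
    by rewrite !mulr_ge0 ?exprn_ge0 ?mulr_ge0 // ltW.
  by have := ler_wpM2l m3 l2; lra.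
pose S : R := Num.sqrt (n%:R / m%:R ^+ 3).
have S0 : 0 <= S by exact: sqrtr_ge0.
have SS : S ^+ 2 * m%:R ^+ 3 = n%:R.
  rewrite sqr_sqrtr ?divr_ge0 ?exprn_ge0 //.
  by rewrite divfK // expf_neq0 // gt_eqF.
pose i0 : 'I_m := Ordinal (ltnW m2).
rewrite mul1r -/S (normalised_disc HM i0) ?expR_ge0 //.
rewrite -[leRHS]fineK ?fin_num_measure //; last first.
  by apply: measurable_disc_le; rewrite ?expR_ge0 // => j; exact: (measurable_normalised HM).
rewrite lee_fin.
apply: le_trans (disc_small_probability m2 n_large
  (normalised_isotropic HM i0) (normalised_indep HM i0) S0 SS).
by rewrite lerD2l lerN2; exact: error_le.
Qed.
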